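(* Let $\sigma=\{\sigma_z\}_{z\in\mathbb{Z}}$ be i.i.d. strictly positive random variables with law $\mathbf{P}$, and suppose $L(x):=1/\mathbf{P}(\sigma_0>x)$ is slowly varying at infinity, i.e. $\lim_{u\to\infty}L(uv)/L(u)=1$ for every $v>0$. Let $\{X_s\}_{s\ge0}$ be the Bouchaud trap model in the landscape $\sigma$ started at $X_0=0$, with quenched law $P_\sigma$. Then, as $t\to\infty$, \[ P_\sigma(X_t\in\Gamma_t)\to 1 \quad\text{in } \mathbf{P}\text{-probability}.\]
   Context: The Bouchaud trap model (BTM) in the landscape $\sigma$ is the continuous-time Markov chain on $\mathbb{Z}$ with transition rates $w_{z\to y}=\frac{1}{2\sigma_z}$ if $|z-y|=1$ and $0$ otherwise; $P_\sigma$ denotes its law given $\sigma$ with $X_0=0$. Define $\ell_t:=\min\{s\ge0: sL(s)\ge t\}$, $r_t:=L(\ell_t)$, $Z^{(1)}_t:=\min\{z\in\mathbb{Z}^+:\sigma_z>\ell_t\}$, $Z^{(2)}_t:=\max\{z\in\mathbb{Z}^-:\sigma_z>\ell_t\}$ (with $\mathbb{Z}^+$ the positive and $\mathbb{Z}^-$ the non-positive integers), and $\Gamma_t:=\{Z^{(1)}_t,Z^{(2)}_t\}$. *)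

(* Defs.v *)
From HB Require Import structures.
From mathcomp Require Import all_boot all_order all_algebra.
From mathcomp Require Import all_classical all_reals all_analysis.
Set Implicit Arguments. Unset Strict Implicit. Unset Printing Implicit Defensive.
Import Order.TTheory GRing.Theory Num.Theory.
Import numFieldNormedType.Exports.
Local Open Scope classical_set_scope.
Local Open Scope ring_scope.

Definition mutually_independent {d} {Omega : measurableType d} {R : realType}
  (P : probability Omega R) {I : eqType} (X : I -> Omega -> R) : Prop :=
  forall (J : seq I) (B : I -> set R), uniq J ->
    (forall j, j \in J -> measurable (B j)) ->
    P (\bigcap_(j in [set j | j \in J]) (X j @^-1` B j)) =
    (\prod_(j <- J) P (X j @^-1` B j))%E.

Definition identically_distributed {d} {Omega : measurableType d} {R : realType}
  (P : probability Omega R) {I : Type} (X : I -> Omega -> R) : Prop :=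
  forall (i j : I) (B : set R), measurable B ->
    P (X i @^-1` B) = P (X j @^-1` B).

Definition Ltail {d} {Omega : measurableType d} {R : realType}
  (P : probability Omega R) (sig : int -> Omega -> R) (x : R) : R :=
  (fine (P [set w | x < sig 0%Z w]))^-1.

Definition slowly_varying {R : realType} (L : R -> R) : Prop :=
  forall v : R, 0 < v -> (fun u => L (u * v) / L u) @ +oo --> (1 : R).

Definition ell {d} {Omega : measurableType d} {R : realType}
  (P : probability Omega R) (sig : int -> Omega -> R) (t : R) : R :=
  inf [set s : R | 0 <= s /\ t <= s * Ltail P sig s].

(* Gamma_t = {Z1_t, Z2_t}: Z1_t = min {z > 0 : sigma_z > ell_t},
   Z2_t = max {z <= 0 : sigma_z > ell_t}. Membership characterization. *)
Definition Gamma {d} {Omega : measurableType d} {R : realType}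
  (P : probability Omega R) (sig : int -> Omega -> R) (t : R) (w : Omega)
  : set int :=
  [set z | (0 < z)%R /\ ell P sig t < sig z w /\
           (forall y : int, (0 < y)%R -> (y < z)%R -> sig y w <= ell P sig t)]
  `|`
  [set z | (z <= 0)%R /\ ell P sig t < sig z w /\
           (forall y : int, (z < y)%R -> (y <= 0)%R -> sig y w <= ell P sig t)].

(* Walk randomness on an abstract probability space W: V (inl n) are the
   +-1 steps of the jump chain, V (inr n) are i.i.d. Exp(1) variables;
   the holding time at site z is s z * Exp(1) (total jump rate 1/s_z,
   each neighbour chosen with probability 1/2, i.e. rate 1/(2 s_z)). *)
Section BTM.
Context {d} {W : measurableType d} {R : realType}.

Definition jump_chain (V : nat + nat -> W -> R) (n : nat) (w : W) : int :=
  \sum_(k < n) (if 0 < V (inl (k : nat)) w then (1 : int) else (-1 : int)).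

Definition hold_time (s : int -> R) (V : nat + nat -> W -> R) (n : nat) (w : W) : R :=
  s (jump_chain V n w) * V (inr n) w.

Definition jump_time (s : int -> R) (V : nat + nat -> W -> R) (n : nat) (w : W) : R :=
  \sum_(k < n) hold_time s V (k : nat) w.

Definition BTM_event (s : int -> R) (V : nat + nat -> W -> R) (t : R) (A : set int)
  : set W :=
  [set w | exists n : nat, jump_time s V n w <= t /\ t < jump_time s V n.+1 w /\
                           A (jump_chain V n w)].

Definition BTM_prob (Q : probability W R) (s : int -> R) (V : nat + nat -> W -> R)
  (t : R) (A : set int) : R := fine (Q (BTM_event s V t A)).

Definition BTM_randomness (Q : probability W R) (V : nat + nat -> W -> R) : Prop :=
  (forall i, measurable_fun setT (V i)) /\
  mutually_independent Q V /\
  (forall n, Q [set w | V (inl n) w = 1] = (1/2)%:E /\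
             Q [set w | V (inl n) w = -1] = (1/2)%:E) /\
  (forall n (x : R), 0 <= x -> Q [set w | x < V (inr n) w] = (expR (- x))%:E).
End BTM.

(* Main.v *)
(** The jump chain [S] of the trap model is a simple random walk, and [T n], the
    time of its [n]-th jump, accumulates independent exponential clocks scaled
    by the depths.  Write [l] for [ell t], [q] for the probability that a trap
    is deeper than [l], and [z1], [z2] for the two sites of Gamma_t.

    Environment.  Slow variation gives, with high probability, that [z1] and
    [z2] are within O(1/q) of the origin, are deeper than [M * l] for any fixed
    [M], and that all the other sites between them, or within [m] ~ delta/q of
    them, are shallower than [l] and have total depth o(l) (Karamata).

    Walk in a fixed landscape.  Lyapunov functions of the jump chain bound the
    time to reach {z1, z2} (by the Green function of the gap) and the
    probability of leaving [[z2 - m, z1 + m]] before time [t] (by the distance to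
    the gap, which grows only at visits to [z1] or [z2]: at most about
    [t / (M * l)] of these happen before [t]).  After {z1, z2} has been hit, the
    expected number of departures from any site [y] per unit time is at most
    max (1/s z1) (1/s z2), by a maximum principle; integrating over one holding
    time, the walk is at [y] at the fixed time [t] with probability at most
    [s y / (M * l)].  Summing over the shallow sites near {z1, z2} concludes. *)
Require Import Defs.
From HB Require Import structures.
From mathcomp Require Import all_boot all_order all_algebra.
From mathcomp Require Import all_classical all_reals all_analysis.
From mathcomp Require Import measurable_realfun lra ring zify.
Import Order.TTheory GRing.Theory Num.Theory.
Import numFieldNormedType.Exports.
Local Open Scope classical_set_scope.
Local Open Scope ring_scope.
Set Implicit Arguments.
Unset Strict Implicit.
Unset Printing Implicit Defensive.

(** * Independence of the past *)

(** Why the scales fit: by [ell_balance], [t * q] is comparable with [l]. The gap has width about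
    1/q and total depth o(l), so crossing it takes time o(l/q) = o(t). Leaving the neighbourhood
    takes about [m], of order delta/q, visits to a trap, each of mean length above [M * l], so a
    time of order [M * delta * t]. [M] is chosen after delta, and slow variation allows any [M]
    because a depth lies in []l, M * l]] with probability o(q). The obstacle is that [t] is a single
    deterministic time, while Green functions control time averages only. Hence the bounds on
    departures are densities: they hold for every window []a, b]] and are proportional to [b - a].
    No stopping times appear. Events are cut off at a finite number [N] of jumps, conditioning is
    Fubini's theorem over finitely many coordinates, and killing is the indicator of an event that
    decreases with the step. *)

Section past.
Context {d} {W : measurableType d} {R : realType} {I : choiceType}.
Variables (Q : probability W R) (V : I -> W -> R).

(** Pi-system of the coordinates in [J]. The sigma-algebra it generates is put on [W] itself as the
    type [past J], so that to depend only on these coordinates is ordinary measurability at another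
    type. *)
Definition cylinders (J : seq I) : set (set W) :=
  [set \bigcap_(j in [set j | j \in J]) (V j @^-1` B j)
    | B in [set B : I -> set R | forall j, measurable (B j)]].

Local Notation past J := (g_sigma_algebraType (cylinders J)).

Lemma cylinders_setI (J : seq I) : setI_closed (cylinders J).
Proof.
move=> _ _ [B mB <-] [C mC <-]; exists (fun j => B j `&` C j).
  by move=> j; exact: measurableI.
rewrite predeqE => w; split => [BC|[Bw Cw] j jJ]; last first.
  by split; [exact: Bw|exact: Cw].
by split=> j jJ; case: (BC _ jJ).
Qed.

Lemma cylindersT (J : seq I) : cylinders J [set: W].
Proof. by exists (fun=> setT) => //; rewrite predeqE => w; split. Qed.

Lemma measurable_past (J : seq I) (j : I) : j \in J ->
  measurable_fun [set: past J] (V j : past J -> R).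
Proof.
move=> jJ _ B mB; rewrite setTI; apply: sub_sigma_algebra.
exists (fun i => if i == j then B else setT); first by move=> i; case: ifP.
rewrite predeqE => w; split => [/(_ j jJ)|Bw i _]; first by rewrite /= eqxx.
by rewrite /=; case: eqP => // ->.
Qed.

Hypothesis mV : forall i, measurable_fun setT (V i).

Lemma past_measurable (J : seq I) (A : set W) :
  measurable (A : set (past J)) -> measurable A.
Proof.
apply: smallest_sub; first exact: sigma_algebra_measurable.
move=> _ [B mB <-].
rewrite bigcap_seq.
apply: bigsetI_measurable => j _.
by rewrite -[X in measurable X]setTI; exact: mV.
Qed.

Lemma measurable_id_past (J : seq I) :
  measurable_fun setT (id : W -> past J).
Proof. by move=> _ A mA; rewrite setTI; exact: past_measurable mA. Qed.

Hypothesis indV : mutually_independent Q V.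

(** As functions of [A], both sides are finite measures: [Q] restricted to the event on [V i], and
    [Q] scaled by its probability. They agree on the pi-system of cylinders, where the claim is
    mutual independence over [i :: J], hence on all of the past. *)
Lemma past_independent (J : seq I) (i : I) (A : set W) (B : set R) :
  uniq (i :: J) -> measurable (A : set (past J)) -> measurable B ->
  (Q (A `&` V i @^-1` B) = Q A * Q (V i @^-1` B))%E.
Proof.
move=> uJ mA mB.
have mVB : measurable (V i @^-1` B).
  by rewrite -[X in measurable X]setTI; exact: mV.
have Qp : 0 <= fine (Q (V i @^-1` B)) by exact: fine_ge0.
pose m2 := mscale (NngNum Qp) Q.
have m2E X : m2 X = (Q X * Q (V i @^-1` B))%E.
  by rewrite /m2 /mscale/= fineK ?fin_num_measure// muleC.
rewrite -m2E.
rewrite -[LHS]/(mrestr Q mVB A).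
apply: (g_sigma_algebra_measure_unique (cylinders J) _ (fun=> setT)) => //.
- by move=> C GC; apply: (@past_measurable J); exact: sub_sigma_algebra.
- by move=> _; exact: cylindersT.
- by rewrite predeqE => w; split=> // _; exists 0%N.
- exact: cylinders_setI.
- move=> _ [C mC <-].
  rewrite [RHS]m2E /mrestr.
  (* Since [i] is not in [J], the constraint at [i] is free to be [B]. *)
  pose D j := if j == i then B else C j.
  have mD j : measurable (D j) by rewrite /D; case: ifP.
  have /andP[iJ uJ'] := uJ.
  have := @indV (i :: J) D uJ (fun j _ => mD j).
  rewrite big_cons (_ : D i = B) ?/D ?eqxx// (eq_big_seq (fun j => Q (V j @^-1` C j))).
    rewrite -(@indV J C uJ' (fun j _ => mC j)) muleC => <-.
    congr (Q _); rewrite predeqE => w; split.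
      move=> [Cw Bw] j /=; rewrite inE.
      by case: eqP => [->//|_ /=]; exact: Cw.
    move=> Dw; split.
      move=> j /= jJ; have := Dw j; rewrite /= inE jJ orbT.
      by case: eqP => [ji|_]; [rewrite -ji jJ in iJ|exact].
    by have := Dw i; rewrite /= inE eqxx; exact.
  by move=> j jJ; case: eqP => // ji; rewrite -ji jJ in iJ.
- move=> k /=; rewrite /mrestr setTI (le_lt_trans (probability_le1 Q mVB))//.
  by rewrite ltry.
Qed.

Section fubini.
Variables (J : seq I) (i : I) (nu : probability R R).
Hypothesis uJ : uniq (i :: J).
Hypothesis lawV : forall B, measurable B -> Q (V i @^-1` B) = nu B.
Variable f : (past J * R)%type -> \bar R.
Hypothesis mf : measurable_fun setT f.
Hypothesis f0 : forall x, (0 <= f x)%E.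

Let id_mixin := isMeasurableFun.Build _ _ _ _ _ (@measurable_id_past J).
Let idp : {mfun W >-> past J} := HB.pack (id : W -> past J) id_mixin.

Let Qp : probability (past J) R :=
  distribution Q idp.

Let Vi (w : W) : (past J * R)%type := (w, V i w).

Let mVi : measurable_fun setT Vi.
Proof. by apply/measurable_fun_pairP; split; [exact: measurable_id_past|exact: mV]. Qed.

Let Vi_mixin := isMeasurableFun.Build _ _ _ _ _ mVi.
Let Vip : {mfun W >-> (past J * R)%type} := HB.pack Vi Vi_mixin.

Let QVi : probability (past J * R)%type R :=
  distribution Q Vip.

(** Independence makes the joint law of the past and [V i] a product, because the two measures agree
    on rectangles. Fubini then conditions on the past. *)
Let QViE A : measurable A -> (Qp \x nu)%E A = QVi A.
Proof.
move=> mA; apply: product_measure_unique => //= B C mB mC.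
rewrite /distribution /pushforward/= preimage_id -lawV// -past_independent//.
Qed.

Let joint : (\int[Q]_w f (w, V i w) = \int[Qp \x nu]_x f x)%E.
Proof.
transitivity (\int[QVi]_x f x)%E.
  by rewrite ge0_integral_distribution.
by apply: eq_measure_integral => A mA _; exact/esym/QViE.
Qed.

Lemma past_fubini1 :
  (\int[Q]_w f (w, V i w) = \int[Q]_w \int[nu]_x f (w, x))%E.
Proof.
rewrite joint fubini_tonelli1// ge0_integral_distribution//=.
  exact: measurable_fun_fubini_tonelli_F.
by move=> w; apply: integral_ge0.
Qed.

Lemma past_fubini2 :
  (\int[Q]_w f (w, V i w) = \int[nu]_x \int[Q]_w f (w, x))%E.
Proof.
rewrite joint fubini_tonelli2//; apply: eq_integral => x _.
rewrite /fubini_G ge0_integral_distribution//=.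
exact: (measurableT_comp mf (measurable_pair2 x)).
Qed.

End fubini.
End past.

Notation past V J := (g_sigma_algebraType (cylinders V J)).

(** * Measurability of the walk; exponential laws *)

Section measurable_comparison.
Context {d} {T : measurableType d} {R : realType}.
Variables f g : T -> R.
Hypotheses (mf : measurable_fun setT f) (mg : measurable_fun setT g).

Lemma measurable_set_lt : measurable [set x | f x < g x].
Proof.
have := measurable_fun_ltr mf mg.
by move=> /(_ measurableT [set true] I); rewrite setTI.
Qed.

Lemma measurable_set_le : measurable [set x | f x <= g x].
Proof.
have := measurable_fun_ler mf mg.
by move=> /(_ measurableT [set true] I); rewrite setTI.
Qed.

End measurable_comparison.

Lemma measurable_preimageT {d d'} {T : measurableType d} {T' : measurableType d'}
    (f : T -> T') (A : set T') :
  measurable_fun setT f -> measurable A -> measurable (f @^-1` A).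
Proof. by move=> mf mA; rewrite -[X in measurable X]setTI; exact: mf. Qed.

Lemma measurable_set_oc {d} {T : measurableType d} {R : realType}
    (f : T -> R) (a b : R) :
  measurable_fun setT f -> measurable [set x | a < f x <= b].
Proof.
move=> mf; rewrite (_ : [set _ | _] = f @^-1` `]a, b]%classic).
  by apply: measurable_preimageT => //; exact: measurable_itv.
by rewrite predeqE => x /=; rewrite in_itv.
Qed.

Lemma measurable_set_fst {d1 d2} (T1 : measurableType d1)
    (T2 : measurableType d2) (A : set T1) :
  measurable A -> measurable [set p : (T1 * T2)%type | A p.1].
Proof. exact: (measurable_preimageT measurable_fst). Qed.

Lemma measurable_comp_fst {d1 d2 d3} (T1 : measurableType d1)
    (T2 : measurableType d2) (T3 : measurableType d3) (f : T1 -> T3) :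
  measurable_fun setT f ->
  measurable_fun setT (fun p : (T1 * T2)%type => f p.1).
Proof. by move=> mf; exact: (measurableT_comp mf measurable_fst). Qed.

Lemma measurable_select {d} {T : measurableType d} {R : realType}
    (g : T -> int) (f : int -> T -> R) :
  (forall z, measurable [set x | g x = z]) ->
  (forall z, measurable_fun setT (f z)) ->
  measurable_fun setT (fun x => f (g x) x).
Proof.
move=> mg mf _ B mB; rewrite setTI.
rewrite (_ : _ @^-1` _ = \bigcup_z ([set x | g x = z] `&` f z @^-1` B)).
  apply: countable_bigcupT_measurable => [|z]; first exact: countableP.
  by apply: measurableI => //; exact: measurable_preimageT.
rewrite predeqE => x; split => [Bx|[z _ []] /= <- //].
by exists (g x).
Qed.

Section jump_chain_measurable.
Context {d} {T : measurableType d} {R : realType}.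
Implicit Types V : nat + nat -> T -> R.

Lemma jump_chain0 V w : jump_chain V 0 w = 0.
Proof. by rewrite /jump_chain big_ord0. Qed.

Lemma jump_chainS V n w : jump_chain V n.+1 w =
  jump_chain V n w + (if 0 < V (inl n) w then 1 else -1).
Proof. by rewrite /jump_chain big_ord_recr. Qed.

Lemma jump_chain_eqS V n z : [set w | jump_chain V n.+1 w = z] =
  ([set w | jump_chain V n w = z - 1] `&` [set w | 0 < V (inl n) w]) `|`
  ([set w | jump_chain V n w = z + 1] `&` ~` [set w | 0 < V (inl n) w]).
Proof.
rewrite predeqE => w; rewrite /= jump_chainS; split.
  by case: ifPn => V0 <-; [left|right]; split; rewrite ?addrK ?subrK//; exact/negP.
by case=> -[-> /= V0]; [rewrite V0; lia|move/negP/negbTE: V0 => ->; lia].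
Qed.

Lemma measurable_jump_chain V n z :
  (forall k, (k < n)%N -> measurable_fun setT (V (inl k))) ->
  measurable [set w | jump_chain V n w = z].
Proof.
elim: n z => [z _|n IH z mV].
  rewrite (_ : [set _ | _] = if z == 0 then setT else set0); first by case: ifP.
  by rewrite predeqE => w /=; rewrite jump_chain0; case: eqP => [->|zn0]; split => // /esym.
have mn : measurable [set w | 0 < V (inl n) w].
  by apply: measurable_set_lt => //; exact: mV.
rewrite jump_chain_eqS.
by apply: measurableU; apply: measurableI => //;
  [apply: IH => k kn; apply: mV; exact: ltnW|
   apply: IH => k kn; apply: mV; exact: ltnW|exact: measurableC].
Qed.

(** [s] may depend on the sample point, which serves both a fixed landscape and joint measurability
    in landscape and walk. The last chain position used is the one at [n - 1], so the steps involved
    stop one earlier than the clocks. *)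
Lemma measurable_holding_sum V (s : int -> T -> R) n :
  (forall k, (k.+1 < n)%N -> measurable_fun setT (V (inl k))) ->
  (forall k, (k < n)%N -> measurable_fun setT (V (inr k))) ->
  (forall z, measurable_fun setT (s z)) ->
  measurable_fun setT
    (fun w => \sum_(k < n) s (jump_chain V k w) w * V (inr (k : nat)) w).
Proof.
move=> mVl mVr ms; apply: measurable_sum => k.
apply: measurable_funM; last exact: mVr.
apply: measurable_select => // z.
by apply: measurable_jump_chain => j jk; apply: mVl; exact: leq_ltn_trans jk _.
Qed.

Lemma measurable_jump_time (s : int -> R) V n :
  (forall k, (k.+1 < n)%N -> measurable_fun setT (V (inl k))) ->
  (forall k, (k < n)%N -> measurable_fun setT (V (inr k))) ->
  measurable_fun setT (jump_time s V n).
Proof.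
move=> mVl mVr.
by apply: (measurable_holding_sum (s := fun z _ => s z)).
Qed.

Lemma jump_time0 (s : int -> R) V w : jump_time s V 0 w = 0.
Proof. by rewrite /jump_time big_ord0. Qed.

Lemma jump_timeS (s : int -> R) V n w :
  jump_time s V n.+1 w = jump_time s V n w + s (jump_chain V n w) * V (inr n) w.
Proof. by rewrite /jump_time big_ord_recr. Qed.

End jump_chain_measurable.

Section past_mono.
Context {d} {W : measurableType d} {R : realType} {I : choiceType}.
Variables (V : I -> W -> R) (J J' : seq I).
Hypothesis JJ' : {subset J <= J'}.

Lemma past_mono (A : set W) :
  measurable (A : set (past V J)) -> measurable (A : set (past V J')).
Proof.
apply: smallest_sub; first exact: (sigma_algebra_measurable (past V J')).
move=> _ [B mB <-]; rewrite bigcap_seq big_seq.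
apply: bigsetI_measurable => j jJ.
apply: (measurable_preimageT (T := past V J')) (mB j).
by apply: measurable_past; exact: JJ'.
Qed.

End past_mono.

Section exponential_law.
Context {R : realType} (nu : probability R R).
Hypothesis tail : forall x : R, 0 <= x -> nu `]x, +oo[%classic = (expR (- x))%:E.

Lemma exponential_tail_neg (x : R) : x <= 0 -> nu `]x, +oo[%classic = 1%E.
Proof.
move=> x0; apply/eqP; rewrite eq_le; apply/andP; split.
  by apply: probability_le1; exact: measurable_itv.
have <- : nu `]0, +oo[%classic = 1%E by rewrite tail// oppr0 expR0.
apply: le_measure; rewrite ?inE; [exact: measurable_itv..|].
by apply: subset_itvr; rewrite bnd_simp.
Qed.

Lemma exponential_tail_max (x : R) : nu `]x, +oo[%classic = (expR (- Num.max x 0))%:E.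
Proof.
have [x0|x0] := leP x 0.
  by rewrite oppr0 expR0 exponential_tail_neg.
by rewrite tail// ltW.
Qed.

Lemma exponential_itv (a b : R) : a <= b ->
  nu `]a, b]%classic = (expR (- Num.max a 0) - expR (- Num.max b 0))%:E.
Proof.
move=> ab.
have -> : `]a, b]%classic = `]a, +oo[%classic `\` `]b, +oo[%classic :> set R.
  rewrite predeqE => x /=; rewrite !in_itv/= !andbT; split.
    by move=> /andP[ax xb]; split => //; apply/negP; rewrite -leNgt.
  by move=> [-> /negP]; rewrite -leNgt.
rewrite measureD//=; last by rewrite ltey_eq fin_num_measure.
rewrite setIidr; last by apply: subset_itvr; rewrite bnd_simp.
by rewrite !exponential_tail_max EFinB.
Qed.

(** By the layer-cake formula the mean is the integral of the tail, which at rate 1 coincides with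
    the density. The positive part loses nothing, since [nu] is carried by the positive reals. *)
Lemma exponential_mean : (\int[nu]_x (Num.max x 0)%:E = 1)%E.
Proof.
pose X : R -> R := fun x => Num.max x 0.
have mX : measurable_fun setT X by apply: measurable_maxr.
pose X_mixin := isMeasurableFun.Build _ _ _ _ _ mX.
pose X' : {mfun R >-> R} := HB.pack X X_mixin.
have := @ge0_expectation_ccdf _ _ _ nu X'.
rewrite expectation_def => -> /=; last first.
  by move=> x; rewrite /X le_max lexx orbT.
rewrite -(integral_exponential_pdf (ltr01 : 0 < (1 : R))).
rewrite integral_mkcond; apply: eq_integral => x _.
rewrite patchE; case: ifPn => x0.
  move: x0; rewrite inE/= in_itv/= andbT => x0.
  rewrite exponential_pdfE// mul1r mulN1r -tail//.
  rewrite /ccdf /distribution /pushforward; congr (nu _).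
  rewrite predeqE => y /=; rewrite !in_itv/= !andbT /X; split.
    by rewrite lt_max [x < 0]ltNge x0 orbF.
  by move=> xy; rewrite lt_max xy.
rewrite lt0_exponential_pdf//.
by move: x0; rewrite notin_setE/= in_itv/= andbT => /negP; rewrite -ltNge.
Qed.

(* The expected part of a holding time falling in a window of length [L] at
   distance [c] equals the probability that it ends there: this is where the
   density of the exponential law enters. *)
Lemma exponential_overlap (c L : R) : 0 <= c -> 0 <= L ->
  (nu `]c, (c + L)%R]%classic = \int[nu]_x (Num.min (Num.max (x - c) 0) L)%:E)%E.
Proof.
move=> c0 L0.
pose X : R -> R := fun x => Num.min (Num.max (x - c) 0) L.
have mX : measurable_fun setT X.
  by apply: measurable_minr => //; apply: measurable_maxr => //; apply: measurable_funB.
pose X_mixin := isMeasurableFun.Build _ _ _ _ _ mX.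
pose X' : {mfun R >-> R} := HB.pack X X_mixin.
have := @ge0_expectation_ccdf _ _ _ nu X'.
rewrite expectation_def => -> /=; last first.
  by move=> x; rewrite /X le_min le_max lexx orbT.
rewrite exponential_itv; last by rewrite lerDl.
rewrite !max_l ?addr_ge0//.
have [L00|Ln0] := eqVneq L 0.
  rewrite L00 addr0 subrr; apply/esym; apply: integral0_eq => x /=.
  rewrite in_itv/= andbT => x0.
  rewrite /ccdf /distribution /pushforward (_ : _ @^-1` _ = set0) ?measure0//.
  rewrite predeqE => y; split => //=; rewrite in_itv/= andbT /X lt_min.
  by move=> /andP[_]; rewrite L00 ltNge x0.
have Lgt0 : 0 < L by rewrite lt_neqAle eq_sym Ln0.
transitivity ((expR (- c))%:E * exponential_prob 1%R (`[0, L]%classic)%R)%E.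
  rewrite exponential_prob_itv0c// -EFinB -EFinM mulrBr mulr1 mulN1r -expRD opprD.
  by [].
rewrite /exponential_prob -integral_itv_bndo_bndc; last first.
  apply/measurable_EFinP; apply: measurable_funTS.
  exact: measurable_exponential_pdf.
rewrite -ge0_integralZl//=; last first.
- by move=> x _; rewrite lee_fin exponential_pdf_ge0.
- apply/measurable_EFinP; apply: measurable_funTS.
  exact: measurable_exponential_pdf.
rewrite integral_mkcond [RHS]integral_mkcond; apply: eq_integral => x _.
rewrite !patchE; case: ifPn => [|xL].
  rewrite inE/= in_itv/= => /andP[x0 xL].
  rewrite ifT; last by rewrite inE/= in_itv/= andbT.
  rewrite exponential_pdfE// mul1r mulN1r -EFinM -expRD -opprD -tail ?addr_ge0//.
  rewrite /ccdf /distribution /pushforward; congr (nu _).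
  rewrite predeqE => y /=; rewrite !in_itv/= !andbT /X lt_min xL andbT lt_max.
  rewrite ltrBrDl; split=> [->//|/orP[//|]].
  by rewrite ltNge x0.
case: ifPn => // x0.
rewrite /ccdf /distribution /pushforward (_ : _ @^-1` _ = set0) ?measure0//.
move: xL x0; rewrite notin_setE inE/= !in_itv/= andbT => /negP + x0.
rewrite x0/= -leNgt => Lx.
rewrite predeqE => y; split => //=; rewrite in_itv/= andbT /X lt_min.
by move=> /andP[_]; rewrite ltNge Lx.
Qed.

End exponential_law.

Lemma eq_law_of_tails {R : realType} (nu1 nu2 : probability R R) :
  (forall x : R, nu1 `]x, +oo[%classic = nu2 `]x, +oo[%classic) ->
  forall B, measurable B -> nu1 B = nu2 B.
Proof.
move=> h B mB.
apply: (measure_unique (RGenOInfty.G (R:=R)) (fun n => `]- n%:R, +oo[%classic)) => //.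
- exact: RGenOInfty.measurableE.
- move=> _ _ [x ->] [y ->]; exists (Num.max x y).
  rewrite predeqE => z /=; rewrite !in_itv/= !andbT gt_max.
  by split=> [[-> ->]|/andP[-> ->]].
- by move=> i; exists (- i%:R).
- rewrite predeqE => x; split => // _; exists (Num.truncn `|x|).+1 => //=.
  rewrite in_itv/= andbT ltrNl.
  by apply: le_lt_trans (truncnS_gt _); rewrite -normrN ler_norm.
- by move=> _ [x ->]; exact: h.
- move=> k; rewrite (le_lt_trans (probability_le1 _ _)) ?ltry//.
Qed.

(** * Integrals conditioned on the past *)

Section past_integrals.
Context {d} {W : measurableType d} {R : realType} {I : choiceType}.
Variables (Q : probability W R) (V : I -> W -> R).
Hypothesis mV : forall i, measurable_fun setT (V i).

Lemma past_measurable_fun (J : seq I) {d'} {T : measurableType d'}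
    (h : W -> T) :
  measurable_fun setT (h : past V J -> T) -> measurable_fun setT h.
Proof.
move=> mh _ B mB; rewrite setTI; apply: (past_measurable mV (J := J)).
exact: (measurable_preimageT mh mB).
Qed.

Hypothesis indV : mutually_independent Q V.
Variables (J : seq I) (i : I) (nu : probability R R).
Hypothesis uJ : uniq (i :: J).
Hypothesis lawV : forall B, measurable B -> Q (V i @^-1` B) = nu B.

Lemma past_integralM (h : W -> R) (k : R -> R) :
  measurable_fun setT (h : past V J -> R) -> measurable_fun setT k ->
  (forall w, 0 <= h w) -> (forall x, 0 <= k x) ->
  (\int[Q]_w (h w * k (V i w))%:E =
   (\int[Q]_w (h w)%:E) * \int[nu]_x (k x)%:E)%E.
Proof.
move=> mh mk h0 k0.
pose f (p : (past V J * R)%type) := (h p.1 * k p.2)%:E.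
have mf : measurable_fun setT f.
  apply/measurable_EFinP; apply: measurable_funM.
    exact: (measurableT_comp (f := h : past V J -> R) mh measurable_fst).
  exact: (measurableT_comp mk measurable_snd).
rewrite [LHS](past_fubini1 mV indV uJ lawV mf) /f/=; last first.
  by move=> p; rewrite lee_fin mulr_ge0.
under eq_integral.
  move=> w _; under eq_integral do rewrite EFinM.
  rewrite ge0_integralZl_EFin//; last 2 first.
  - by move=> x _; rewrite lee_fin.
  - exact/measurable_EFinP.
  over.
rewrite ge0_integralZr//.
- by apply/measurable_EFinP; exact: past_measurable_fun mh.
- by move=> w _; rewrite lee_fin.
- by apply: integral_ge0 => x _; rewrite lee_fin.
Qed.

Lemma measurable_pair_past :
  measurable_fun setT (fun w : W => (w, V i w) : past V J * R).
Proof.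
by apply/measurable_fun_pairP; split; [exact: (measurable_id_past mV)|exact: mV].
Qed.

Lemma measurable_past_comp {d'} {U : measurableType d'}
    (f : (past V J * R)%type -> U) :
  measurable_fun setT f -> measurable_fun setT (fun w => f (w, V i w)).
Proof. by move=> mf; exact: (measurableT_comp mf measurable_pair_past). Qed.

(** Conditioning: an inequality between integrals may be checked with the past [w] frozen, where
    only the law of one coordinate remains. *)
Lemma past_le_integral (f1 f2 : (past V J * R)%type -> \bar R) :
  measurable_fun setT f1 -> measurable_fun setT f2 ->
  (forall p, 0 <= f1 p)%E -> (forall p, 0 <= f2 p)%E ->
  (forall w, \int[nu]_x f1 (w, x) <= \int[nu]_x f2 (w, x))%E ->
  (\int[Q]_w f1 (w, V i w) <= \int[Q]_w f2 (w, V i w))%E.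
Proof.
move=> mf1 mf2 f10 f20 le12.
rewrite (past_fubini1 mV indV uJ lawV mf1)// (past_fubini1 mV indV uJ lawV mf2)//.
apply: ge0_le_integral => //.
- by move=> w _; apply: integral_ge0.
- apply: (past_measurable_fun (J := J)).
  exact: measurable_fun_fubini_tonelli_F.
- apply: (past_measurable_fun (J := J)).
  exact: measurable_fun_fubini_tonelli_F.
Qed.

Section sections.
Variable D : set (past V J * R)%type.
Hypothesis mD : measurable D.

Let mf : measurable_fun setT (fun p => (\1_D p)%:E : \bar R).
Proof. by apply/measurable_EFinP; exact: measurable_indic. Qed.

Let joint : Q [set w | D (w, V i w)] = (\int[Q]_w (\1_D (w, V i w))%:E)%E.
Proof.
rewrite -[in LHS](setIT [set w | D (w, V i w)]) -integral_indic//.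
exact: (measurable_preimageT measurable_pair_past mD).
Qed.

(** The opposite order of conditioning: the value [x] of the new coordinate is frozen and the past
    stays random. *)
Lemma past_section :
  Q [set w | D (w, V i w)] = (\int[nu]_x Q [set w | D (w, x)])%E.
Proof.
rewrite joint (past_fubini2 mV indV uJ lawV mf)//.
apply: eq_integral => x _.
rewrite -[in RHS](setIT [set w | D (w, x)]) -integral_indic//.
apply: (past_measurable mV (J := J)).
apply: (measurable_preimageT (T' := (past V J * R)%type)
  (f := pair^~ x)) mD.
exact: pair2_measurable.
Qed.

Lemma measurable_past_section :
  measurable_fun setT (fun x => Q [set w | D (w, x)]).
Proof.
have mD' : measurable (D : set (W * R)%type).
  pose g (p : (W * R)%type) : (past V J * R)%type := p.
  have mg : measurable_fun setT g.
    apply/measurable_fun_pairP; split.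
      move=> _ B mB; rewrite setTI.
      exact: (measurable_preimageT measurable_fst (past_measurable mV (J := J) mB)).
    exact: measurable_snd.
  exact: (measurable_preimageT mg mD).
have := measurable_fun_ysection Q mD'.
apply: eq_measurable_fun => x _ /=; congr (Q _).
by rewrite predeqE => w; rewrite /ysection/= inE.
Qed.

End sections.
End past_integrals.

Lemma past_integral_indic {d} {W : measurableType d} {R : realType}
    {I : choiceType} (Q : probability W R) (V : I -> W -> R) (J : seq I) (i : I)
    (h : W -> R) (B : set R) :
  (forall i, measurable_fun setT (V i)) -> mutually_independent Q V ->
  uniq (i :: J) -> measurable_fun setT (h : past V J -> R) ->
  (forall w, 0 <= h w) -> measurable B ->
  (\int[Q]_w (h w * \1_B (V i w))%:E =
   (\int[Q]_w (h w)%:E) * Q (V i @^-1` B))%E.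
Proof.
move=> mV indV uJ mh h0 mB.
pose X_mixin := isMeasurableFun.Build _ _ _ _ _ (mV i).
pose X : {mfun W >-> R} := HB.pack (V i) X_mixin.
rewrite (past_integralM (nu := distribution Q X) mV indV uJ)//.
by rewrite integral_indic// setIT.
Qed.

Lemma measure_bigsetU_seq_le {d} {T : measurableType d} {R : realType}
    (mu : {measure set T -> \bar R}) {I : Type} (r : seq I) (F : I -> set T) :
  (forall i, measurable (F i)) ->
  (mu (\big[setU/set0]_(i <- r) F i) <= \sum_(i <- r) mu (F i))%E.
Proof.
move=> mF; elim: r => [|i r IH]; first by rewrite !big_nil measure0.
rewrite !big_cons; apply: le_trans (leeD (lexx _) IH).
by apply: measureU2 => //; exact: bigsetU_measurable.
Qed.

(** * Time spent in a window *)

Section clamp.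
Context {R : realType}.
Implicit Types a b x : R.

(** Projection onto [[a, b]]. Between successive jump times its increment is the part of the sojourn
    lying in the window, and these increments telescope. *)
Definition clamp a b x := Num.max a (Num.min x b).

Lemma clamp_ge a b x : a <= clamp a b x.
Proof. by rewrite /clamp le_max lexx. Qed.

Lemma clamp_le a b x : a <= b -> clamp a b x <= b.
Proof. by move=> ab; rewrite /clamp ge_max ab ge_min lexx orbT. Qed.

Lemma le_clamp a b x y : x <= y -> clamp a b x <= clamp a b y.
Proof. by move=> xy; apply: le_max2 => //; apply: le_min2. Qed.

Lemma measurable_clamp a b : measurable_fun setT (clamp a b).
Proof. by apply: measurable_maxr => //; apply: measurable_minr. Qed.

(** The right side is the length of the overlap of [[x, x + u]] with [[a, b]], in the form used by
    [exponential_overlap]: a wait [Num.max (a - x) 0] until the window opens, then a cap at the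
    length still available. *)
Lemma clampD a b x u : a <= b -> x <= b -> 0 <= u ->
  clamp a b (x + u) - clamp a b x =
  Num.min (Num.max (u - Num.max (a - x) 0) 0) (b - Num.max a x).
Proof.
move=> ab xb u0; rewrite /clamp (min_l xb).
have [ax|/ltW xa] := leP a x.
  rewrite (max_r (_ : a - x <= 0)) ?subr_le0// subr0 (max_l u0).
  have [h|/ltW h] := leP (x + u) b.
    by rewrite max_r ?min_l; lra.
  by rewrite max_r ?min_r; lra.
rewrite (max_l (_ : 0 <= a - x)) ?subr_ge0//.
have [h|/ltW h] := leP a (x + u); last first.
  by rewrite [in RHS]max_r ?min_l ?max_l; lra.
rewrite [in RHS]max_l ?subr_ge0; last by lra.
have [h'|/ltW h'] := leP (x + u) b.
  by rewrite max_r ?min_l; lra.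
by rewrite max_r ?min_r; lra.
Qed.

End clamp.

Section departures_bound.
Context {R : realType} (nu : probability R R).
Hypothesis tail : forall x : R, 0 <= x -> nu `]x, +oo[%classic = (expR (- x))%:E.

(** In units of [sigma] the window starts at distance [c] and has length [L], and
    [exponential_overlap] equates the probability of ending in it with the mean overlap. If the
    start [tau] is beyond [b], the left side is zero. *)
Lemma exponential_clamp (a b tau sigma : R) : a <= b -> 0 < sigma ->
  (sigma%:E * nu [set x | (a < tau + sigma * x <= b)%R] <=
   \int[nu]_x (clamp a b (tau + sigma * Num.max x 0) - clamp a b tau)%:E)%E.
Proof.
move=> ab s0.
have -> : [set x | a < tau + sigma * x <= b] =
    `](a - tau) / sigma, (b - tau) / sigma]%classic.
  rewrite predeqE => x /=; rewrite in_itv/= ltr_pdivrMr// ler_pdivlMr//.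
  by rewrite ltrBlDl lerBrDl mulrC.
have ab' : (a - tau) / sigma <= (b - tau) / sigma.
  by rewrite ler_pM2r ?invr_gt0// lerB.
have [taub|btau] := leP tau b; last first.
  rewrite exponential_itv// !max_r ?subrr ?mule0; last 2 first.
  - by rewrite pmulr_lle0 ?invr_gt0// subr_le0 ltW.
  - by rewrite pmulr_lle0 ?invr_gt0// subr_le0 (le_trans ab) ?ltW.
  apply: integral_ge0 => x _; rewrite lee_fin subr_ge0 le_clamp//.
  by rewrite lerDl mulr_ge0 ?(ltW s0)// le_max lexx orbT.
pose c := Num.max (a - tau) 0 / sigma.
pose L := (b - Num.max a tau) / sigma.
have c0 : 0 <= c by rewrite divr_ge0 ?(ltW s0)// le_max lexx orbT.
have L0 : 0 <= L by rewrite divr_ge0 ?(ltW s0)// subr_ge0 ge_max ab.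
have cL : c + L = (b - tau) / sigma.
  rewrite /c /L -mulrDl; congr (_ / _).
  by rewrite /Num.max; case: ifPn; case: ifPn; rewrite -?leNgt => *; lra.
have -> : nu `](a - tau) / sigma, (b - tau) / sigma]%classic = nu `]c, (c + L)]%classic.
  rewrite exponential_itv// exponential_itv ?lerDl// -cL.
  congr (expR (- _) - _)%:E; rewrite (max_l c0).
  have := @maxr_pMl _ sigma^-1 (a - tau) 0.
  by rewrite mul0r => <-//; rewrite invr_ge0 ltW.
rewrite exponential_overlap// -ge0_integralZl_EFin//; last 3 first.
- by move=> x _; rewrite lee_fin le_min L0 le_max lexx orbT.
- apply/measurable_EFinP; apply: measurable_minr => //.
  by apply: measurable_maxr => //; apply: measurable_funB.
- exact: ltW.
apply: ge0_le_integral => //.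
- by move=> x _; rewrite -EFinM lee_fin mulr_ge0 ?(ltW s0)// le_min L0 le_max lexx orbT.
- apply/measurable_EFinP; apply: measurable_funM => //; apply: measurable_minr => //.
  by apply: measurable_maxr => //; apply: measurable_funB.
- apply/measurable_EFinP; apply: measurable_funB => //.
  apply: (measurableT_comp (@measurable_clamp R a b)).
  apply: measurable_funD => //; apply: measurable_funM => //.
  exact: measurable_maxr.
move=> x _; rewrite -EFinM lee_fin clampD//; last first.
  by rewrite mulr_ge0 ?(ltW s0)// le_max lexx orbT.
have sc : sigma * c = Num.max (a - tau) 0 by rewrite /c mulrC divfK ?gt_eqF.
have sL : sigma * L = b - Num.max a tau by rewrite /L mulrC divfK ?gt_eqF.
rewrite minr_pMr ?(ltW s0)// maxr_pMr ?(ltW s0)// mulr0 mulrBr sc sL.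
by apply: le_min2 => //; apply: le_max2 => //; rewrite lerB// ler_pM2l// le_max lexx.
Qed.

End departures_bound.

(** * The walk in a fixed landscape *)

Section walk.
Context {d} {W : measurableType d} {R : realType}.
Variables (Q : probability W R) (V : nat + nat -> W -> R) (nu : probability R R).
Variable s : int -> R.
Hypothesis mV : forall i, measurable_fun setT (V i).
Hypothesis indV : mutually_independent Q V.
Hypothesis stepP : forall n, Q [set w | 0 < V (inl n) w] = (1 / 2)%:E.
Hypothesis lawV : forall n B, measurable B -> Q (V (inr n) @^-1` B) = nu B.
Hypothesis tail : forall x : R, 0 <= x -> nu `]x, +oo[%classic = (expR (- x))%:E.
Hypothesis V_gt0 : forall n w, 0 < V (inr n) w.
Hypothesis s_gt0 : forall z, 0 < s z.

Notation S := (jump_chain V).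
Notation T := (jump_time s V).

Definition before (n : nat) : seq (nat + nat) :=
  map inl (iota 0 n) ++ map inr (iota 0 n).

(** Once the [n]-th clock is revealed, the time of the next jump is known but its direction is not:
    [T n.+1] depends on [held n], while [S n.+1] needs the further coordinate [inl n]. The direction
    is therefore independent of the time at which it is taken. *)
Definition held (n : nat) : seq (nat + nat) := inr n :: before n.

Lemma inl_before n k : (inl k \in before n) = (k < n)%N.
Proof.
rewrite mem_cat mem_map; last by move=> ? ? [].
by rewrite mem_iota add0n /= (introF mapP) ?orbF// => -[].
Qed.

Lemma inr_before n k : (inr k \in before n) = (k < n)%N.
Proof.
rewrite mem_cat orbC mem_map; last by move=> ? ? [].
by rewrite mem_iota add0n /= (introF mapP) ?orbF// => -[].
Qed.

Lemma uniq_held n : uniq (held n).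
Proof.
rewrite /= inr_before ltnn /= cat_uniq !map_inj_uniq ?iota_uniq/=; try by move=> ? ? [].
by rewrite andbT; apply/hasPn => _ /mapP[k _ ->]; apply/negP => /mapP[].
Qed.

Lemma uniq_step n : uniq (inl n :: held n).
Proof. by rewrite cons_uniq uniq_held inE/= inl_before ltnn. Qed.

Lemma before_leq m n : (m <= n)%N -> {subset before m <= before n}.
Proof.
by move=> mn [k|k]; rewrite ?inl_before ?inr_before => /leq_trans; apply.
Qed.

Lemma before_held n (A : set W) :
  measurable (A : set (past V (before n))) ->
  measurable (A : set (past V (held n))).
Proof. by apply: past_mono => i; rewrite inE orbC => ->. Qed.

Lemma before_le m n (A : set W) : (m <= n)%N ->
  measurable (A : set (past V (before m))) ->
  measurable (A : set (past V (before n))).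
Proof. by move=> /before_leq h; exact: past_mono. Qed.

Lemma past_chain n z :
  measurable ([set w | S n w = z] : set (past V (before n))).
Proof.
apply: (@measurable_jump_chain _ (past V (before n))) => k kn.
by apply: measurable_past; rewrite inl_before.
Qed.

Arguments past_chain : clear implicits.

Lemma past_time n : measurable_fun setT (T n : past V (before n) -> R).
Proof.
apply: (@measurable_jump_time _ (past V (before n))) => k kn.
  by apply: measurable_past; rewrite inl_before ltnW.
by apply: measurable_past; rewrite inr_before.
Qed.

Lemma past_chain_pred n (p : int -> Prop) :
  measurable ([set w | p (S n w)] : set (past V (before n))).
Proof.
rewrite (_ : [set _ | _] = \bigcup_(z in [set z | p z]) [set w | S n w = z]).
  rewrite bigcup_mkcond; apply: countable_bigcupT_measurable => [|z].
    exact: countableP.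
  by case: ifP => // _; exact: past_chain.
by rewrite predeqE => w; split => [pS|[z pz /= ->//]]; exists (S n w).
Qed.

Arguments past_time : clear implicits.
Arguments past_chain_pred : clear implicits.

Lemma past_chain_fun n (f : int -> R) :
  measurable_fun setT ((fun w => f (S n w)) : past V (before n) -> R).
Proof.
move=> _ B mB; rewrite setTI.
exact: (past_chain_pred n (fun z => B (f z))).
Qed.

Lemma measurable_chain n z : measurable [set w | S n w = z].
Proof. by apply: (past_measurable mV (J := before n)); exact: past_chain. Qed.

Lemma measurable_time n : measurable_fun setT (T n).
Proof. by apply: (past_measurable_fun mV (J := before n)); exact: past_time. Qed.

Lemma held_time n : measurable_fun setT (T n.+1 : past V (held n) -> R).
Proof.
apply: (@measurable_jump_time _ (past V (held n))) => k kn;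
  apply: measurable_past; rewrite inE.
  by rewrite inl_before -ltnS kn orbT.
by rewrite inr_before; move: kn; rewrite ltnS leq_eqVlt => /predU1P[->|->];
  rewrite ?eqxx ?orbT.
Qed.

Lemma step_half n : Q (~` [set w | 0 < V (inl n) w]) = (1 / 2)%:E.
Proof.
rewrite probability_setC; last by apply: measurable_set_lt.
by rewrite stepP -EFinB; congr EFin; lra.
Qed.

Lemma measurable_step n : measurable [set w | 0 < V (inl n) w].
Proof. exact: measurable_set_lt. Qed.

Lemma time0 w : T 0 w = 0. Proof. exact: jump_time0. Qed.

Lemma time_lt n w : T n w < T n.+1 w.
Proof. by rewrite jump_timeS ltrDl mulr_gt0. Qed.

Lemma time_le m n w : (m <= n)%N -> T m w <= T n w.
Proof.
elim: n => [|n IH]; first by rewrite leqn0 => /eqP->.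
by rewrite leq_eqVlt => /predU1P[->//|/IH h]; apply: le_trans h (ltW (time_lt _ _)).
Qed.

(** The step [inl n] is independent of [held n], so [A] may involve the very time [T n.+1] at which
    the step is made. *)
Lemma step_split n (A : set W) y :
  measurable (A : set (past V (held n))) ->
  (Q (A `&` [set w | S n.+1 w = y]) =
   (1 / 2)%:E * Q (A `&` [set w | S n w = (y - 1)%R]) +
   (1 / 2)%:E * Q (A `&` [set w | S n w = (y + 1)%R]))%E.
Proof.
move=> mA.
have mSA z : measurable (A `&` [set w | S n w = z] : set (past V (held n))).
  by apply: measurableI => //; apply: before_held; exact: past_chain.
have mstep : measurable (`]0, +oo[%classic : set R) by exact: measurable_itv.
have stepE : [set w | 0 < V (inl n) w] = V (inl n) @^-1` `]0, +oo[%classic.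
  by rewrite predeqE => w /=; rewrite in_itv/= andbT.
have hp z : Q ((A `&` [set w | S n w = z]) `&` [set w | 0 < V (inl n) w]) =
    ((1 / 2)%:E * Q (A `&` [set w | S n w = z]))%E.
  rewrite stepE (past_independent mV indV (uniq_step n) (mSA z))//.
  by rewrite -stepE stepP muleC.
have hm z : Q ((A `&` [set w | S n w = z]) `&` ~` [set w | 0 < V (inl n) w]) =
    ((1 / 2)%:E * Q (A `&` [set w | S n w = z]))%E.
  rewrite stepE preimage_setC (past_independent mV indV (uniq_step n) (mSA z)).
    by rewrite -preimage_setC -stepE step_half muleC.
  exact: measurableC.
rewrite jump_chain_eqS setIUr !setIA measureU.
- by congr (_ + _)%E; [exact: hp|exact: hm].
- apply: measurableI; last exact: measurable_step.
  by apply: (past_measurable mV (J := held n)); exact: mSA.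
- apply: measurableI; last exact/measurableC/measurable_step.
  by apply: (past_measurable mV (J := held n)); exact: mSA.
- by rewrite predeqE => w; split => //= -[[_ h] [_ /(_ h)]].
Qed.

(** * Departures from one site in a time window *)

Section departures.
Variables (z : int) (a b : R).
Hypothesis ab : a <= b.

Let D n := [set p : (past V (before n) * R)%type |
  S n p.1 = z /\ a < T n p.1 + s z * p.2 <= b].

Arguments D : clear implicits.

Let mtime1 n :
  measurable_fun setT (fun p : (past V (before n) * R)%type => T n p.1).
Proof. exact: (measurableT_comp (past_time n) measurable_fst). Qed.

Let mD n : measurable (D n).
Proof.
apply: measurableI.
  exact: (@measurable_set_fst _ _ (past V (before n)) R _ (past_chain n z)).
apply: (measurable_set_oc (f := fun p : (past V (before n) * R)%type =>
  T n p.1 + s z * p.2)).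
by apply: measurable_funD => //; apply: measurable_funM.
Qed.

(** With the past before [n] frozen, this is [exponential_clamp] for a sojourn at [z] begun at
    [T n w]. Off the event [S n w = z] both sides vanish. *)
Let departure_le n :
  ((s z)%:E * Q ([set w | S n w = z] `&` [set w | (a < T n.+1 w <= b)%R]) <=
   \int[Q]_w (\1_[set w | S n w = z] w *
     (clamp a b (T n.+1 w) - clamp a b (T n w)))%:E)%E.
Proof.
pose f1 (p : (past V (before n) * R)%type) := (s z * \1_(D n) p)%:E.
pose f2 (p : (past V (before n) * R)%type) := (\1_[set w | S n w = z] p.1 *
  (clamp a b (T n p.1 + s z * Num.max p.2 0) - clamp a b (T n p.1)))%:E.
have mf1 : measurable_fun setT f1.
  by apply/measurable_EFinP; apply: measurable_funM => //; exact: measurable_indic.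
have mf2 : measurable_fun setT f2.
  apply/measurable_EFinP; apply: measurable_funM.
    apply: (@measurable_comp_fst _ _ _ (past V (before n)) R R
      \1_[set w | S n w = z]).
    by apply: measurable_indic; exact: past_chain.
  apply: measurable_funB.
    apply: (measurableT_comp (@measurable_clamp R a b)).
    apply: measurable_funD => //; apply: measurable_funM => //.
    exact: measurable_maxr.
  exact: (measurableT_comp (@measurable_clamp R a b)).
have f10 p : (0 <= f1 p)%E by rewrite lee_fin mulr_ge0 ?(ltW (s_gt0 _)).
have f20 p : (0 <= f2 p)%E.
  rewrite lee_fin mulr_ge0// subr_ge0 le_clamp// lerDl mulr_ge0 ?(ltW (s_gt0 _))//.
  by rewrite le_max lexx orbT.
have := past_le_integral mV indV (uniq_held n) (@lawV n) mf1 mf2 f10 f20.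
rewrite (_ : (\int[Q]_w f1 _)%E = ((s z)%:E *
    Q ([set w | S n w = z] `&` [set w | (a < T n.+1 w <= b)%R]))%E); last first.
  rewrite /f1; under eq_integral do rewrite EFinM.
  rewrite ge0_integralZl_EFin//; last 2 first.
  - apply/measurable_EFinP.
    have mDn : measurable_fun setT (\1_(D n) : _ -> R) by exact: measurable_indic.
    exact: (measurable_past_comp mV (inr n) mDn).
  - exact: ltW.
  congr (_ * _)%E; rewrite -[in RHS](setIT (_ `&` _)) -integral_indic//; last first.
    apply: measurableI; first exact: measurable_chain.
    exact: measurable_set_oc (measurable_time _).
  apply: eq_integral => w _; congr EFin; rewrite !indicE.
  congr (nat_of_bool _)%:R; apply/idP/idP; rewrite !inE /D/= jump_timeS.
    by move=> [Sz]; rewrite Sz.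
  by move=> [Sz]; rewrite Sz.
rewrite [X in (_ -> _ <= X)%E](_ : _ = \int[Q]_w f2 (w, V (inr n) w))%E.
  apply => w.
  have [Sz|Sz] := pselect (S n w = z); last first.
    rewrite integral0_eq.
      by apply: integral_ge0 => x _; exact: f20.
    by move=> x _; rewrite /f1 indicE memNset ?mulr0// => -[].
  have := exponential_clamp tail (T n w) ab (s_gt0 z).
  rewrite (_ : (\int[nu]_x f1 _)%E =
    ((s z)%:E * nu [set x | (a < T n w + s z * x <= b)%R])%E); last first.
    rewrite /f1; under eq_integral do rewrite EFinM.
    have mset : measurable [set x | a < T n w + s z * x <= b].
      apply: (measurable_set_oc (f := fun x : R => T n w + s z * x)).
      by apply: measurable_funD => //; apply: measurable_funM.
    have E x : \1_(D n) (w, x) = \1_[set x | a < T n w + s z * x <= b] x :> R.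
      rewrite !indicE; congr (nat_of_bool _)%:R; apply/idP/idP; rewrite !inE /D/=.
        by move=> [].
      by [].
    under eq_integral do rewrite E.
    rewrite ge0_integralZl_EFin//; last 2 first.
    - by apply/measurable_EFinP; exact: measurable_indic.
    - exact: ltW.
    by rewrite integral_indic// setIT.
  move=> /le_trans; apply; rewrite le_eqVlt; apply/orP; left; apply/eqP.
  by apply: eq_integral => x _; rewrite /f2/= indicE mem_set// mul1r.
apply: eq_integral => w _; rewrite /f2/= jump_timeS; congr EFin.
rewrite !indicE; case: (boolP (w \in _)) => [|_]; last by rewrite !mul0r.
by rewrite inE/= => ->; rewrite max_l// ltW.
Qed.

(** [s z] times the left side is at most the expected time spent at [z] within the window, and the
    time spent at all sites together telescopes to at most [b - a]. *)
Lemma departures_le N :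
  (\sum_(n < N) Q ([set w | S n w = z] `&` [set w | (a < T n.+1 w <= b)%R]) <=
   ((b - a) / s z)%:E)%E.
Proof.
have mclampT n : measurable_fun setT (fun w => clamp a b (T n w)).
  exact: (measurableT_comp (@measurable_clamp R a b) (measurable_time n)).
have mdiff n m : measurable_fun setT
    (fun w => (clamp a b (T n w) - clamp a b (T m w))%:E).
  by apply/measurable_EFinP; apply: measurable_funB.
have tele : ((s z)%:E *
    \sum_(n < N) Q ([set w | S n w = z] `&` [set w | (a < T n.+1 w <= b)%R]) <=
    \int[Q]_w (clamp a b (T N w) - clamp a b (T 0 w))%:E)%E.
  elim: N => [|N IH].
    rewrite big_ord0 mule0 integral_ge0// => w _.
    by rewrite lee_fin subr_ge0.
  rewrite big_ord_recr /= ge0_muleDr ?sume_ge0//.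
  apply: le_trans (leeD IH (departure_le N)) _.
  rewrite -ge0_integralD//; last 3 first.
  - by move=> w _; rewrite lee_fin subr_ge0 le_clamp// time_le.
  - by move=> w _; rewrite lee_fin mulr_ge0// subr_ge0 le_clamp// ltW// time_lt.
  - apply/measurable_EFinP; apply: measurable_funM; last exact: measurable_funB.
    by apply: measurable_indic; exact: measurable_chain.
  apply: ge0_le_integral => //.
  - move=> w _; rewrite -EFinD lee_fin addr_ge0//.
      by rewrite subr_ge0 le_clamp// time_le.
    by rewrite mulr_ge0// subr_ge0 le_clamp// ltW// time_lt.
  - apply: emeasurable_funD => //.
    apply/measurable_EFinP; apply: measurable_funM; last exact: measurable_funB.
    by apply: measurable_indic; exact: measurable_chain.
  move=> w _; rewrite -EFinD lee_fin.
  have : clamp a b (T N w) <= clamp a b (T N.+1 w).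
    by rewrite le_clamp// ltW// time_lt.
  rewrite indicE; case: (w \in _) => /= h; rewrite ?mul1r ?mul0r; lra.
rewrite mulrC EFinM lee_pdivlMl//.
apply: le_trans tele _.
apply: (@le_trans _ _ (\int[Q]_w (b - a)%:E)%E).
  apply: ge0_le_integral => //.
  - by move=> w _; rewrite lee_fin subr_ge0 le_clamp// time_le.
  move=> w _; rewrite lee_fin lerB ?clamp_ge ?clamp_le//.
by rewrite integral_cst// [X in (_ * X)%E]probability_setT mule1.
Qed.

End departures.

(** Each next clock is independent of the past and all have the law [nu], so the whole sum can be
    bounded for one frozen value [x] common to its terms, and then integrated. *)
Lemma sum_past_le N (A : nat -> set W) (D : set (R * R)%type) (k : R -> R) :
  (forall n, measurable (A n : set (past V (before n.+1)))) -> measurable D ->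
  measurable_fun setT k -> (forall x, 0 <= k x) ->
  (forall x, \sum_(n < N) Q (A n `&` [set w | D (T n.+1 w, x)]) <= (k x)%:E)%E ->
  (\sum_(n < N) Q (A n `&` [set w | D (T n.+1 w, V (inr n.+1) w)]) <=
    \int[nu]_x (k x)%:E)%E.
Proof.
move=> mA mD mk k0 leQ.
pose D' n : set (past V (before n.+1) * R)%type :=
  [set p | A n p.1 /\ D (T n.+1 p.1, p.2)].
have mD' n : measurable (D' n : set (past V (before n.+1) * R)%type).
  apply: measurableI.
    exact: (@measurable_set_fst _ _ (past V (before n.+1)) R _ (mA n)).
  have mf : measurable_fun setT
      (fun p : (past V (before n.+1) * R)%type => (T n.+1 p.1, p.2)).
    apply/measurable_fun_pairP; split; last exact: measurable_snd.
    exact: (@measurable_comp_fst _ _ _ (past V (before n.+1)) R R _ (past_time n.+1)).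
  exact: (measurable_preimageT mf mD).
have sectE n : Q (A n `&` [set w | D (T n.+1 w, V (inr n.+1) w)]) =
    (\int[nu]_x Q (A n `&` [set w | D (T n.+1 w, x)]))%E.
  exact: (past_section mV indV (uniq_held n.+1) (@lawV n.+1) (mD' n)).
have msect n : measurable_fun setT
    (fun x => Q (A n `&` [set w | D (T n.+1 w, x)])).
  exact: (@measurable_past_section _ _ _ _ Q V mV _ _ (mD' n)).
under eq_bigr do rewrite sectE.
rewrite -ge0_integral_sum//.
apply: ge0_le_integral => //.
- by move=> x _; apply: sume_ge0.
- exact: emeasurable_sum.
- exact/measurable_EFinP.
Qed.

(** * Departures and occupation after the first visit to [G] *)

Section occupation.
Variables (G : pred int) (C : R).
Hypothesis C_ge0 : 0 <= C.
Hypothesis C_s : forall z, G z -> 1 <= C * s z.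

Definition hit n := [set w | exists2 k, (k <= n)%N & G (S k w)].

Lemma past_hit n : measurable (hit n : set (past V (before n))).
Proof.
rewrite (_ : hit n = \bigcup_(k in [set k | (k <= n)%N]) [set w | G (S k w)]).
  rewrite bigcup_mkcond; apply: bigcupT_measurable => k.
  case: ifPn => // kn; apply: (@before_le k); first by rewrite inE in kn.
  exact: (past_chain_pred k (fun z => G z)).
by rewrite predeqE => w; split => -[k kn Gk]; exists k.
Qed.

(** Arriving outside [G] adds no hit, so the condition can be read off before the last step; this is
    what allows that step to be averaged by [step_split]. *)
Lemma hitS n y : ~~ G y ->
  hit n.+1 `&` [set w | S n.+1 w = y] = hit n `&` [set w | S n.+1 w = y].
Proof.
move=> nGy; rewrite predeqE => w; split => -[[k kn Gk] /= Sy]; split => //.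
  move: kn; rewrite leq_eqVlt => /predU1P[kn|kn]; last by exists k.
  by rewrite kn Sy (negbTE nGy) in Gk.
by exists k => //; exact: leqW.
Qed.

Lemma hit0 y : ~~ G y -> hit 0 `&` [set w | S 0 w = y] = set0.
Proof.
move=> nGy; rewrite predeqE => w; split => // -[[k + Gk] /= Sy].
by rewrite leqn0 => /eqP k0; rewrite k0 Sy (negbTE nGy) in Gk.
Qed.

Lemma past_hit_chain n y :
  measurable (hit n `&` [set w | S n.+1 w = y] : set (past V (before n.+1))).
Proof.
apply: measurableI; last exact: past_chain.
by apply: (@before_le n) => //; exact: past_hit.
Qed.

Lemma measurable_hit n : measurable (hit n).
Proof. by apply: (past_measurable mV (J := before n)); exact: past_hit. Qed.

(** Uniformity in [y] serves the average over the two neighbours, and uniformity in the window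
    serves the shift by a holding time. The cut-off [N] is the induction variable. *)
Definition departure_density N := forall y a b, a <= b ->
  (\sum_(n < N) Q (hit n `&` [set w | S n w = y] `&`
     [set w | (a < T n.+1 w <= b)%R]) <= (C * (b - a))%:E)%E.

(** An arrival at [y] is a departure from a neighbour at the same instant, and a departure from
    either neighbour leads to [y] with probability 1/2. *)
Lemma arrival_density N : departure_density N -> forall y a b, a <= b ->
  (\sum_(n < N) Q (hit n `&` [set w | S n.+1 w = y] `&`
     [set w | (a < T n.+1 w <= b)%R]) <= (C * (b - a))%:E)%E.
Proof.
move=> IH y a b ab.
have splitE n : Q (hit n `&` [set w | S n.+1 w = y] `&`
     [set w | (a < T n.+1 w <= b)%R]) =
   ((1 / 2)%:E * Q (hit n `&` [set w | S n w = (y - 1)%R] `&`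
                    [set w | (a < T n.+1 w <= b)%R]) +
    (1 / 2)%:E * Q (hit n `&` [set w | S n w = (y + 1)%R] `&`
                    [set w | (a < T n.+1 w <= b)%R]))%E.
  rewrite setIAC step_split; last first.
    apply: measurableI; first by apply: before_held; exact: past_hit.
    exact: (measurable_set_oc (T := past V (held n)) a b (@held_time n)).
  by rewrite ![_ `&` _ `&` [set w | S n w = _]]setIAC.
under eq_bigr do rewrite splitE.
rewrite big_split/= -!ge0_sume_distrr//.
apply: (@le_trans _ _ ((1 / 2)%:E * (C * (b - a))%:E +
                       (1 / 2)%:E * (C * (b - a))%:E)%E).
  by apply: leeD; apply: lee_wpmul2l; rewrite ?lee_fin//; exact: IH.
by rewrite -!EFinM -EFinD lee_fin; lra.
Qed.

(* A maximum principle: departures from a site outside [G] are averages of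
   departures from its two neighbours, delayed by an independent holding time,
   so their density cannot exceed the largest density [1 / s z], [z] in [G]. *)
Lemma departure_densityP N : departure_density N.
Proof.
elim: N => [|N IH] y a b ab.
  by rewrite big_ord0 lee_fin mulr_ge0// subr_ge0.
have [Gy|nGy] := boolP (G y).
  apply: (@le_trans _ _ (\sum_(n < N.+1) Q ([set w | S n w = y] `&`
      [set w | (a < T n.+1 w <= b)%R]))%E).
    apply: lee_sum => n _; apply: le_measure; rewrite ?inE.
    - apply: measurableI; last exact: measurable_set_oc (measurable_time _).
      by apply: measurableI; [exact: measurable_hit|exact: measurable_chain].
    - apply: measurableI; last exact: measurable_set_oc (measurable_time _).
      exact: measurable_chain.
    - by move=> w [[]].
  apply: le_trans (departures_le _ ab N.+1) _.
  rewrite lee_fin ler_pdivrMr// mulrAC ler_peMl ?subr_ge0//.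
  exact: C_s.
(* The first term is zero: at step 0, a walk sitting at [y] outside [G] has hit nothing. Shifting
   the index leaves [N] terms, as the induction hypothesis requires. *)
rewrite big_ord_recl /= hit0// set0I measure0 add0e.
have -> : (\sum_(i < N) Q (hit (bump 0 i) `&` [set w | S (bump 0 i) w = y] `&`
      [set w | (a < T (bump 0 i).+1 w <= b)%R]) =
    \sum_(n < N) Q ((hit n `&` [set w | S n.+1 w = y]) `&`
      [set w | [set p : (R * R)%type | (a < p.1 + s y * p.2 <= b)%R]
        (T n.+1 w, V (inr n.+1) w)]))%E.
  apply: eq_bigr => i _; rewrite /bump leq0n add1n hitS//; congr (Q _).
  by rewrite predeqE => w /=; split => -[[hw Sw]]; rewrite (jump_timeS _ _ i.+1) Sw.
apply: (@le_trans _ _ (\int[nu]_x (C * (b - a))%:E)%E); last first.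
  by rewrite integral_cst// [X in (_ * X)%E]probability_setT mule1.
apply: (@sum_past_le N (fun n => hit n `&` [set w | S n.+1 w = y])
  [set p : (R * R)%type | a < p.1 + s y * p.2 <= b] (fun=> C * (b - a))).
- by move=> n; exact: past_hit_chain.
- apply: (measurable_set_oc (f := fun p : (R * R)%type => p.1 + s y * p.2)).
  by apply: measurable_funD => //; apply: measurable_funM.
- by [].
- by move=> _; rewrite mulr_ge0// subr_ge0.
(* A frozen holding time [s y * x] only translates the window. *)
- move=> x.
  have ab' : a - s y * x <= b - s y * x by rewrite lerB.
  have := arrival_density IH y ab'.
  rewrite (_ : b - s y * x - _ = b - a); last by lra.
  move=> h; apply: le_trans h; rewrite le_eqVlt; apply/orP; left; apply/eqP.
  apply: eq_bigr => n _; congr (Q _).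
  rewrite predeqE => w /=; rewrite ltrBlDr lerBrDr.
  by split.
Qed.

(** To be at [y] at time [t], the walk must have arrived within the last [s y * x], where [x] is the
    clock of the current sojourn. Arrivals have density at most [C], and [x] has mean 1. *)
Lemma occupation_le N y t : ~~ G y ->
  (\sum_(n < N) Q (hit n `&` [set w | S n w = y] `&`
     [set w | (T n w <= t < T n.+1 w)%R]) <= (C * s y)%:E)%E.
Proof.
move=> nGy; case: N => [|N].
  by rewrite big_ord0 lee_fin mulr_ge0// ltW.
rewrite big_ord_recl /= hit0// set0I measure0 add0e.
have -> : (\sum_(i < N) Q (hit (bump 0 i) `&` [set w | S (bump 0 i) w = y] `&`
      [set w | (T (bump 0 i) w <= t < T (bump 0 i).+1 w)%R]) =
    \sum_(n < N) Q ((hit n `&` [set w | S n.+1 w = y]) `&`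
      [set w | [set p : (R * R)%type | (p.1 <= t < p.1 + s y * p.2)%R]
        (T n.+1 w, V (inr n.+1) w)]))%E.
  apply: eq_bigr => i _; rewrite /bump leq0n add1n hitS//; congr (Q _).
  by rewrite predeqE => w /=; split => -[[hw Sw]]; rewrite (jump_timeS _ _ i.+1) Sw.
apply: (@le_trans _ _ (\int[nu]_x (C * (s y * Num.max x 0))%:E)%E); last first.
  under eq_integral do rewrite mulrA EFinM.
  rewrite ge0_integralZl_EFin//.
  - by rewrite exponential_mean// mule1.
  - by move=> x _; rewrite lee_fin le_max lexx orbT.
  - by apply/measurable_EFinP; exact: measurable_maxr.
  - by rewrite mulr_ge0// ltW.
apply: (@sum_past_le N (fun n => hit n `&` [set w | S n.+1 w = y])
  [set p : (R * R)%type | p.1 <= t < p.1 + s y * p.2]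
  (fun x => C * (s y * Num.max x 0))).
- by move=> n; exact: past_hit_chain.
- rewrite (_ : [set _ | _] = [set p | p.1 <= t] `&` [set p | t < p.1 + s y * p.2]).
    apply: measurableI; first exact: measurable_set_le.
    apply: measurable_set_lt => //.
    by apply: measurable_funD => //; apply: measurable_funM.
  by rewrite predeqE => p; split => [/andP[]|[/= -> ->]].
- apply: measurable_funM => //; apply: measurable_funM => //.
  exact: measurable_maxr.
- by move=> x; rewrite !mulr_ge0// ?(ltW (s_gt0 _))// le_max lexx orbT.
- move=> x; have [x0|x0] := leP x 0.
    rewrite big1 ?lee_fin ?mulr0// => n _.
    rewrite (_ : _ `&` _ = set0) ?measure0// predeqE => w; split => //= -[_].
    move=> /andP[Tt]; apply/negP; rewrite -leNgt (le_trans _ Tt)//.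
    by rewrite gerDl pmulr_rle0.
  have tx : t - s y * x <= t by rewrite gerBl mulr_ge0// ltW.
  have := arrival_density (departure_densityP N) y tx.
  rewrite (_ : t - (t - s y * x) = s y * x); last by lra.
  move=> h; apply: le_trans h; rewrite le_eqVlt; apply/orP; left; apply/eqP.
  apply: eq_bigr => n _; congr (Q _).
  rewrite predeqE => w /=; rewrite ltrBlDr andbC.
  by split.
Qed.

End occupation.

Lemma measurable_sojourn n t : measurable [set w | T n w <= t < T n.+1 w].
Proof.
rewrite (_ : [set _ | _] = [set w | T n w <= t] `&` [set w | t < T n.+1 w]).
  by apply: measurableI; [apply: measurable_set_le|apply: measurable_set_lt] => //;
    exact: measurable_time.
by rewrite predeqE => w; split => [/andP[]|[/= -> ->]].
Qed.

(** The sojourn intervals are disjoint, so at most one of them contains [t]. *)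
Lemma sum_alive_le N t : 0 <= t ->
  (\sum_(n < N) Q [set w | (T n w <= t < T n.+1 w)%R] <= 1)%E.
Proof.
move=> t0.
have malive n := measurable_sojourn n t.
have mlt n : measurable [set w | t < T n w].
  by apply: measurable_set_lt => //; exact: measurable_time.
suff h : (\sum_(n < N) Q [set w | (T n w <= t < T n.+1 w)%R] <=
    Q [set w | (t < T N w)%R])%E.
  by apply: le_trans h _; exact: probability_le1.
elim: N => [|N IH]; first by rewrite big_ord0 measure_ge0.
rewrite big_ord_recr /=.
apply: le_trans (leeD IH (lexx _)) _.
rewrite -measureU//; last first.
  rewrite predeqE => w; split => //= -[tT /andP[Tt _]].
  by move: tT; rewrite ltNge Tt.
apply: le_measure; rewrite ?inE//; first exact: measurableU.
by move=> w [/= tT|/andP[]//]; exact: lt_trans tT (time_lt _ _).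
Qed.

(** A visit begun by time [t] either has ended by then, and counts as a departure, or is the one in
    progress; the latter accounts for the extra 1. *)
Lemma visits_le N z t : 0 <= t ->
  (\sum_(n < N) Q ([set w | S n w = z] `&` [set w | (T n w <= t)%R]) <=
   (t / s z + 1)%:E)%E.
Proof.
move=> t0; rewrite EFinD.
have := leeD (departures_le z t0 N) (sum_alive_le N t0).
rewrite subr0; apply: le_trans; rewrite -big_split; apply: lee_sum => n _ /=.
have malive := measurable_sojourn n t.
have mdep : measurable ([set w | S n w = z] `&` [set w | 0 < T n.+1 w <= t]).
  apply: measurableI; first exact: measurable_chain.
  exact: measurable_set_oc (measurable_time _).
apply: (@le_trans _ _ (Q (([set w | S n w = z] `&` [set w | (0 < T n.+1 w <= t)%R])
    `|` [set w | (T n w <= t < T n.+1 w)%R]))).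
  apply: le_measure; rewrite ?inE.
  - apply: measurableI; first exact: measurable_chain.
    by apply: measurable_set_le => //; exact: measurable_time.
  - exact: measurableU.
  move=> w [/= Sz Tt]; have [h|h] := leP (T n.+1 w) t; [left|right].
    split=> //; rewrite andbT; apply: le_lt_trans (time_lt n w).
    by rewrite -(time0 w) time_le.
  by rewrite /= Tt.
exact: measureU2.
Qed.

(** * Lyapunov functions for the killed chain *)

Section lyapunov.
Variables (K : nat -> set W).
Hypothesis mK : forall n, measurable (K n : set (past V (before n))).

Lemma measurable_alive n : measurable (K n).
Proof. by apply: (past_measurable mV (J := before n)); exact: mK. Qed.

Lemma past_killed (f : int -> R) n : measurable_fun setT
  ((fun w => \1_(K n) w * f (S n w)) : past V (before n) -> R).
Proof.
apply: measurable_funM; last exact: past_chain_fun.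
by apply: (@measurable_indic _ (past V (before n))); exact: mK.
Qed.

Arguments past_killed : clear implicits.

Lemma measurable_killed (f : int -> R) n :
  measurable_fun setT (fun w => \1_(K n) w * f (S n w)).
Proof. by apply: (past_measurable_fun mV (J := before n)); exact: past_killed. Qed.

Lemma killed_ge0 (f : int -> R) n w :
  (forall z, 0 <= f z) -> 0 <= \1_(K n) w * f (S n w).
Proof. by move=> f0; rewrite mulr_ge0. Qed.

Lemma measurable_killed_next (f : int -> R) n :
  measurable_fun setT (fun w => \1_(K n) w * f (S n.+1 w)).
Proof.
apply: measurable_funM.
  by apply: measurable_indic; exact: measurable_alive.
by apply: (past_measurable_fun mV (J := before n.+1)); exact: past_chain_fun.
Qed.

Lemma integral_step (f : int -> R) n : (forall z, 0 <= f z) ->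
  (\int[Q]_w (\1_(K n) w * f (S n.+1 w))%:E =
   \int[Q]_w (\1_(K n) w * (f (S n w + 1)%R / 2 + f (S n w - 1)%R / 2))%:E)%E.
Proof.
move=> f0.
pose up : set R := `]0, +oo[%classic.
have mup : measurable up by exact: measurable_itv.
pose hp w := \1_(K n) w * f (S n w + 1).
pose hm w := \1_(K n) w * f (S n w - 1).
have hp0 w : 0 <= hp w by rewrite /hp mulr_ge0.
have hm0 w : 0 <= hm w by rewrite /hm mulr_ge0.
have held_fun (h : W -> R) : measurable_fun setT (h : past V (before n) -> R) ->
    measurable_fun setT (h : past V (held n) -> R).
  move=> mh _ B mB; rewrite setTI; apply: before_held.
  exact: (measurable_preimageT mh mB).
have pp : measurable_fun setT (hp : past V (before n) -> R).
  exact: (past_killed (fun z => f (z + 1))).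
have pm : measurable_fun setT (hm : past V (before n) -> R).
  exact: (past_killed (fun z => f (z - 1))).
have mp : measurable_fun setT hp by apply: (past_measurable_fun mV (J := before n)).
have mm : measurable_fun setT hm by apply: (past_measurable_fun mV (J := before n)).
have preup : V (inl n) @^-1` up = [set w | 0 < V (inl n) w].
  by rewrite /up predeqE => w /=; rewrite in_itv/= andbT.
have mindic (B : set R) : measurable B -> measurable_fun setT
    (fun w => \1_B (V (inl n) w) : R).
  move=> mB; rewrite (_ : (fun _ => _) = \1_(V (inl n) @^-1` B)).
    by apply: measurable_indic; exact: measurable_preimageT.
  by apply/funext => w; rewrite !indicE.
transitivity (\int[Q]_w ((hp w * \1_up (V (inl n) w))%:E +
                         (hm w * \1_(~` up) (V (inl n) w))%:E))%E.
  apply: eq_integral => w _; rewrite jump_chainS /hp /hm -EFinD; congr EFin.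
  rewrite !indicE in_setC; have [V0|V0] := boolP (0 < V (inl n) w).
    have -> : V (inl n) w \in up by rewrite inE /up/= in_itv/= V0.
    by rewrite /= mulr0 addr0 mulr1.
  have -> : V (inl n) w \in up = false.
    by apply: memNset; rewrite /up/= in_itv/= (negbTE V0).
  by rewrite /= mulr0 add0r mulr1.
rewrite ge0_integralD//; last 4 first.
- by move=> w _; rewrite lee_fin mulr_ge0.
- by apply/measurable_EFinP; apply: measurable_funM => //; exact: mindic.
- by move=> w _; rewrite lee_fin mulr_ge0.
- apply/measurable_EFinP; apply: measurable_funM => //; apply: mindic.
  exact: measurableC.
rewrite (past_integral_indic mV indV (uniq_step n) (held_fun _ pp) hp0 mup).
rewrite (past_integral_indic mV indV (uniq_step n) (held_fun _ pm) hm0 (measurableC mup)).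
rewrite -preimage_setC preup step_half stepP.
rewrite -!ge0_integralZr ?lee_fin//; try exact/measurable_EFinP;
  try by move=> w _; rewrite lee_fin.
rewrite -ge0_integralD//;
  try (by move=> w _; rewrite -EFinM lee_fin mulr_ge0);
  try (by apply/measurable_EFinP; apply: measurable_funM).
by apply: eq_integral => w _; rewrite -!EFinM -EFinD /hp /hm; congr EFin; lra.
Qed.

(** [g] is a running cost paid out of the mean decrease of [f], and [c] an allowance for places
    where [f] may increase. The one-step inequality telescopes over the steps before killing. *)
Lemma lyapunov (f g c : int -> R) N :
  (forall n, K n.+1 `<=` K n) ->
  (forall z, 0 <= f z) -> (forall z, 0 <= g z) -> (forall z, 0 <= c z) ->
  (forall n w, K n w -> f (S n w + 1) / 2 + f (S n w - 1) / 2 + g (S n w) <=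
                        f (S n w) + c (S n w)) ->
  (\sum_(n < N) \int[Q]_w (\1_(K n) w * g (S n w))%:E <=
   (f 0)%:E + \sum_(n < N) \int[Q]_w (\1_(K n) w * c (S n w))%:E)%E.
Proof.
move=> Kdecr f0 g0 c0 Kf.
(* The terminal value of [f] is kept for the induction and dropped here by nonnegativity. *)
suff h : (\sum_(n < N) \int[Q]_w (\1_(K n) w * g (S n w))%:E +
    \int[Q]_w (\1_(K N) w * f (S N w))%:E <=
    (f 0)%:E + \sum_(n < N) \int[Q]_w (\1_(K n) w * c (S n w))%:E)%E.
  apply: le_trans h; rewrite leeDl// integral_ge0// => w _.
  by rewrite lee_fin killed_ge0.
elim: N => [|N IH].
  rewrite !big_ord0 add0e adde0.
  apply: (@le_trans _ _ (\int[Q]_w (f 0)%:E)%E); last first.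
    by rewrite integral_cst// [X in (_ * X)%E]probability_setT mule1.
  apply: ge0_le_integral => //.
  - by move=> w _; rewrite lee_fin killed_ge0.
  - by apply/measurable_EFinP; exact: measurable_killed.
  - move=> w _; rewrite lee_fin jump_chain0 indicE.
    by case: (_ \in _); rewrite ?mul1r ?mul0r.
rewrite !big_ord_recr /=.
have chain (x y z u v a b : \bar R) : (y + z <= u + v -> x + u <= a + b ->
    (x + y) + z <= a + (b + v))%E.
  move=> yz xu; rewrite -addeA (le_trans (leeD (lexx x) yz))// !addeA.
  exact: leeD.
apply: chain IH.
apply: (@le_trans _ _ (\int[Q]_w (\1_(K N) w * g (S N w))%:E +
    \int[Q]_w (\1_(K N) w * f (S N.+1 w))%:E)%E).
  rewrite leeD//; apply: ge0_le_integral => //.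
  - by move=> w _; rewrite lee_fin killed_ge0.
  - by apply/measurable_EFinP; exact: measurable_killed.
  - by apply/measurable_EFinP; exact: measurable_killed_next.
  move=> w _; rewrite lee_fin ler_wpM2r// !indicE ler_nat.
  by case: (boolP (w \in K N.+1)) => //; rewrite inE => /Kdecr /mem_set ->.
rewrite integral_step//.
have mD (f1 f2 : int -> R) (n : nat) : (forall z, 0 <= f1 z) -> (forall z, 0 <= f2 z) ->
   (\int[Q]_w (\1_(K n) w * f1 (S n w))%:E + \int[Q]_w (\1_(K n) w * f2 (S n w))%:E =
    \int[Q]_w (\1_(K n) w * (f1 (S n w) + f2 (S n w)))%:E)%E.
  move=> f10 f20; rewrite -ge0_integralD//.
  - by apply: eq_integral => w _; rewrite -EFinD -mulrDr.
  - by move=> w _; rewrite lee_fin killed_ge0.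
  - by apply/measurable_EFinP; exact: measurable_killed.
  - by move=> w _; rewrite lee_fin killed_ge0.
  - by apply/measurable_EFinP; exact: measurable_killed.
have avg0 z : 0 <= f (z + 1) / 2 + f (z - 1) / 2 by rewrite addr_ge0// divr_ge0.
rewrite (mD g (fun z => f (z + 1) / 2 + f (z - 1) / 2)%R)// mD//.
apply: ge0_le_integral => //.
- by move=> w _; rewrite lee_fin mulr_ge0// addr_ge0.
- apply/measurable_EFinP.
  exact: (measurable_killed (fun z => g z + (f (z + 1) / 2 + f (z - 1) / 2))).
- by apply/measurable_EFinP; exact: (measurable_killed (fun z => f z + c z)).
move=> w _; rewrite lee_fin indicE.
case: (boolP (w \in _)) => [|_]; last by rewrite !mul0r.
by rewrite inE !mul1r => /Kf; rewrite addrC.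
Qed.

End lyapunov.

Definition stay (p : pred int) n := [set w | forall k, (k <= n)%N -> p (S k w)].

Lemma past_stay p n : measurable (stay p n : set (past V (before n))).
Proof.
rewrite (_ : stay p n = ~` hit (predC p) n).
  by apply: measurableC; exact: past_hit.
rewrite predeqE => w; split => [h [k kn]|h k kn]; first by rewrite /= h.
by apply/negPn/negP => npS; apply: h; exists k.
Qed.

Lemma stay_decr p n : stay p n.+1 `<=` stay p n.
Proof. by move=> w h k kn; apply: h; exact: leqW. Qed.

Lemma integral_killed_cst (K : nat -> set W) (a : R) n :
  measurable (K n) -> 0 <= a ->
  (\int[Q]_w (\1_(K n) w * a)%:E = a%:E * Q (K n))%E.
Proof.
move=> mK a0; under eq_integral do rewrite mulrC EFinM.
rewrite ge0_integralZl_EFin ?integral_indic ?setIT//.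
by apply/measurable_EFinP; exact: measurable_indic.
Qed.

(** * Localization at a fixed time in a fixed landscape *)

Section localization.
Variables (z1 z2 : int) (m : nat) (U : seq int) (t C : R).
Hypotheses (z1_gt0 : 0 < z1) (z2_le0 : z2 <= 0) (t_gt0 : 0 < t) (C_ge0 : 0 <= C).
Hypotheses (C_z1 : 1 <= C * s z1) (C_z2 : 1 <= C * s z2).

Let J : pred int := fun z => (z2 - m%:Z <= z) && (z <= z1 + m%:Z).
Let G : pred int := fun z => (z == z1) || (z == z2).
Let gap : pred int := fun z => (z2 < z) && (z < z1).

Hypothesis JU : forall z, J z -> ~~ G z -> z \in U.
Hypothesis GU : forall z, z \in U -> ~~ G z.

Let Sig : R := \sum_(z <- U) s z.

Let sum0 N (K : nat -> set W) :
  (\sum_(n < N) \int[Q]_w (\1_(K n) w * (fun=> 0) (S n w))%:E = 0)%E.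
Proof. by apply: big1 => n _; apply: integral0_eq => w _; rewrite mulr0. Qed.

(** The quadratic vanishes one step outside [J] on either side and has mean increment exactly -1
    inside, so [f 0] bounds the expected number of steps in [J]. The events [stay J] decrease,
    whence the factor [N]. *)
Let confined N :
  ((N%:R)%:E * Q (stay J N) <=
   ((z1 + m%:Z + 1)%:~R * (m%:Z - z2 + 1)%:~R)%:E)%E.
Proof.
pose f (y : int) : R :=
  (Num.max ((z1 + m%:Z + 1 - y) * (y - z2 + m%:Z + 1)) 0)%:~R.
have f0 z : 0 <= f z by rewrite /f ler0z le_max lexx orbT.
have key n w : stay J n w -> f (S n w + 1) / 2 + f (S n w - 1) / 2 + 1 <= f (S n w) + 0.
  move=> /(_ n (leqnn n)); move: (S n w) => y /andP[y1 y2].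
  rewrite /f !max_l; [|by apply: mulr_ge0; lia..].
  by rewrite !(rmorphM, rmorphB, rmorphD)/=; lra.
have := @lyapunov (stay J) (@past_stay J) f (fun=> 1) (fun=> 0) N (@stay_decr J)
  f0 (fun=> ler01) (fun=> lexx 0) key.
rewrite (@sum0 N (stay J)) adde0.
have -> : f 0 = (z1 + m%:Z + 1)%:~R * (m%:Z - z2 + 1)%:~R.
  rewrite /f max_l; last by apply: mulr_ge0; lia.
  by rewrite subr0 rmorphM; congr (_ * _%:~R); lia.
apply: le_trans.
have mstay n : measurable (stay J n).
  by apply: (past_measurable mV (J := before n)); exact: past_stay.
rewrite (eq_bigr (fun n : 'I_N => Q (stay J n))); last first.
  by move=> n _; rewrite integral_killed_cst// mul1e.
have constE (x : \bar R) k : (0 <= x -> (k%:R)%:E * x = \sum_(n < k) x)%E.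
  move=> x0; elim: k => [|k IH]; first by rewrite big_ord0 mul0e.
  by rewrite big_ord_recr /= -IH -natr1 EFinD ge0_muleDl ?lee_fin// mul1e.
rewrite constE//.
apply: lee_sum => n _; apply: le_measure; rewrite ?inE//.
by move=> w h k kn; apply: h; apply: leq_trans kn _; exact: ltnW.
Qed.

Let gap_time N w : R :=
  \sum_(k < N) \1_(stay gap k) w * s (S k w) * V (inr (k : nat)) w.

Let mgap_time N : measurable_fun setT (gap_time N).
Proof.
apply: measurable_sum => k; apply: measurable_funM => //.
exact: (measurable_killed (@past_stay gap)).
Qed.

Let gap_time_ge0 N w : 0 <= gap_time N w.
Proof.
by apply: sumr_ge0 => k _; rewrite !mulr_ge0// ltW.
Qed.

(** Before leaving the gap, a site of it is visited at most [z1 - z2] times on average, and each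
    visit at [v] lasts [s v] in mean. Summing over the sites bounds the mean of [gap_time], and
    Markov's inequality concludes. *)
Let trapped N :
  (t%:E * Q [set w | (t < gap_time N w)%R] <= ((z1 - z2)%:~R * Sig)%:E)%E.
Proof.
(* This tent replaces the exact Green function of the gap. For [v] and [y] in the gap its argument
   stays in the range where the tent is positive, so it is affine around [y] unless [y = v], where
   its mean increment is -1. *)
pose phi (v y : int) : R := (Num.max (z1 - z2 - `|y - v|) 0)%:~R.
pose f (y : int) : R := \sum_(v <- U) (if gap v then s v * phi v y else 0).
have phi0 v y : 0 <= phi v y by rewrite /phi ler0z le_max lexx orbT.
have f0 y : 0 <= f y.
  by apply: sumr_ge0 => v _; case: ifP => // _; rewrite mulr_ge0// ltW.
have key n w : stay gap n w ->
    f (S n w + 1) / 2 + f (S n w - 1) / 2 + s (S n w) <= f (S n w) + 0.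
  move=> /(_ n (leqnn n)); move: (S n w) => y gy; rewrite addr0.
  have [y1 y2] := andP gy.
  have yU : y \in U.
    by apply: JU; [apply/andP; split|apply/norP; split]; lia.
  apply: (@le_trans _ _ (\sum_(v <- U) ((if gap v then s v * phi v (y + 1) else 0) / 2 +
     (if gap v then s v * phi v (y - 1) else 0) / 2 + s v * (v == y)%:R))).
    rewrite !big_split/= -!mulr_suml lerD2l (big_rem y)//= eqxx mulr1 lerDl.
    by apply: sumr_ge0 => v _; rewrite mulr_ge0// ltW.
  apply: ler_sum => v _; case: ifPn => [/andP[v1 v2]|ngv]; last first.
    rewrite mul0r !add0r; case: eqP => [vy|]; last by rewrite mulr0.
    by rewrite vy gy in ngv.
  rewrite -!mulrA -!mulrDr ler_pM2l//.
  have : (phi v (y + 1) + phi v (y - 1) + 2 * (v == y)%:R <= 2 * phi v y).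
    rewrite /phi -[(v == y)%:R]/(((v == y)%:Z)%:~R).
    rewrite -[2 : R]/((2 : int)%:~R) -!intrM -!intrD ler_int.
    by have [->|vy] := eqVneq v y; lia.
  by lra.
have := @lyapunov (stay gap) (@past_stay gap) f s (fun=> 0) N (@stay_decr gap)
  f0 (fun z => ltW (s_gt0 z)) (fun=> lexx 0) key.
rewrite (@sum0 N (stay gap)) adde0.
have fle : f 0 <= (z1 - z2)%:~R * Sig.
  rewrite /Sig mulr_sumr; apply: ler_sum => v _; case: ifP => _.
    by rewrite mulrC ler_wpM2r ?(ltW (s_gt0 _))// /phi ler_int; lia.
  by rewrite mulr_ge0 ?(ltW (s_gt0 _))// ler0z; lia.
move=> h; have := le_trans h (_ : ((f 0)%:E <= ((z1 - z2)%:~R * Sig)%:E)%E).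
rewrite lee_fin => /(_ fle); apply: le_trans.
have mX : measurable [set w | t < gap_time N w] by exact: measurable_set_lt.
apply: (@le_trans _ _ (\int[Q]_w (gap_time N w)%:E)%E).
  rewrite -[Q _]/(Q [set w | (t < gap_time N w)%R]).
  rewrite -(@integral_killed_cst (fun=> [set w | t < gap_time N w]) t 0%N)//; last exact: ltW.
  apply: ge0_le_integral => //.
  - by move=> w _; rewrite lee_fin mulr_ge0// ltW.
  - apply/measurable_EFinP; apply: measurable_funM => //; exact: measurable_indic.
  - exact/measurable_EFinP.
  move=> w _; rewrite lee_fin indicE; case: (boolP (w \in _)) => [|_].
    by rewrite inE mul1r => /ltW.
  by rewrite mul0r.
rewrite /gap_time; under eq_integral do rewrite -sumEFin.
rewrite ge0_integral_sum//; last 2 first.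
- move=> k; apply/measurable_EFinP; apply: measurable_funM => //.
  exact: (measurable_killed (@past_stay gap)).
- by move=> k w _; rewrite lee_fin !mulr_ge0// ltW.
apply: lee_sum => k _.
rewrite le_eqVlt; apply/orP; left; apply/eqP.
(* The positive part is harmless, the clocks being positive, and turns the clock into the
   nonnegative function integrated by [exponential_mean]. *)
transitivity (\int[Q]_w (\1_(stay gap k) w * s (S k w) *
   (fun x => Num.max x 0) (V (inr (k : nat)) w))%:E)%E.
  by apply: eq_integral => w _; rewrite /= max_l// ltW.
have maxr_ge0 (x : R) : 0 <= Num.max x 0 by rewrite le_max lexx orbT.
have mmax : measurable_fun setT (fun x : R => Num.max x 0) by exact: measurable_maxr.
have ks0 w : 0 <= \1_(stay gap k) w * s (S k w) by rewrite mulr_ge0// ltW.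
have pk : measurable_fun setT
    ((fun w => \1_(stay gap k) w * s (S k w)) : past V (before k) -> R).
  exact: (past_killed (@past_stay gap)).
have := past_integralM mV indV (uniq_held k) (@lawV k) pk mmax ks0 maxr_ge0.
by rewrite exponential_mean// mule1.
Qed.

(** Killing takes place on leaving [J] or after time [t]; the visits to [G] made while alive are
    thus among those bounded by [visits_le]. *)
Let alive n := stay J n `&` [set w | T n w <= t].

Let past_alive n : measurable (alive n : set (past V (before n))).
Proof.
apply: measurableI; first exact: past_stay.
by apply: (@measurable_set_le _ (past V (before n))) => //; exact: past_time.
Qed.

Let alive_decr n : alive n.+1 `<=` alive n.
Proof.
move=> w [h Tt]; split; first exact: stay_decr h.
by apply: le_trans Tt; exact: time_le.
Qed.

Let measurable_pred n (p : pred int) : measurable [set w | p (S n w)].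
Proof.
apply: (past_measurable mV (J := before n)).
exact: (past_chain_pred n (fun z => p z)).
Qed.

Let exit N := \big[setU/set0]_(n < N) (alive n `&` [set w | ~~ J (S n.+1 w)]).

Let measurable_exit N : measurable (exit N).
Proof.
apply: bigsetU_measurable => n _; apply: measurableI.
  exact: (measurable_alive past_alive).
exact: (measurable_pred n.+1 (fun z => ~~ J z)).
Qed.

(* The distance to [[z2, z1]] is harmonic off [G] and only gains 1/2 at each
   departure from [G], so leaving [J] takes about [m] visits to [G]. *)
Let exit_le N : ((m.+1%:R)%:E * Q (exit N) <= (C * t + 1)%:E)%E.
Proof.
pose h (y : int) : int := Num.max (Num.max (y - z1) (z2 - y)) 0.
pose M : R := m.+1%:R.
(* [h] is split into [f] inside [J] and [e] outside: the value [m.+1] that [h] takes one step beyond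
   [J] becomes the reward whose mean is [g]. The walk starts in [[z2, z1]], so [f 0] is zero. *)
pose f (y : int) : R := if J y then (h y)%:~R else 0.
pose e (y : int) : R := if J y then 0 else M.
pose g (y : int) : R := e (y + 1) / 2 + e (y - 1) / 2.
pose c (y : int) : R := (G y)%:R / 2.
have h0 y : (0 <= (h y)%:~R :> R) by rewrite ler0z /h le_max lexx orbT.
have f0 y : 0 <= f y by rewrite /f; case: ifP.
have e0 y : 0 <= e y by rewrite /e; case: ifP => // _; rewrite /M.
have g0 y : 0 <= g y by rewrite addr_ge0// divr_ge0.
have c0 y : 0 <= c y by rewrite divr_ge0.
have feE y y' : J y -> (y' = y + 1) \/ (y' = y - 1) -> f y' + e y' = (h y')%:~R.
  move=> /andP[y1 y2] yy'; rewrite /f /e; case: ifPn => [_|nJ]; first by rewrite addr0.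
  rewrite add0r /M -[m.+1%:R]/((m.+1%:Z)%:~R); congr (_%:~R).
  have : (y' = z1 + m%:Z + 1) \/ (y' = z2 - m%:Z - 1).
    by move: nJ; rewrite /J negb_and -!ltNge => /orP[]; lia.
  by rewrite /h; lia.
have key n w : alive n w -> f (S n w + 1) / 2 + f (S n w - 1) / 2 + g (S n w) <=
    f (S n w) + c (S n w).
  move=> [/(_ n (leqnn n)) + _]; move: (S n w) => y Jy.
  have hp := feE y (y + 1) Jy (or_introl erefl).
  have hm := feE y (y - 1) Jy (or_intror erefl).
  have : (h (y + 1)%R)%:~R + (h (y - 1)%R)%:~R <= 2 * (h y)%:~R + (G y)%:R :> R.
    rewrite -[(G y)%:R]/(((G y)%:Z)%:~R).
    rewrite -[2 : R]/((2 : int)%:~R) -!intrM -!intrD ler_int.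
    by rewrite /h /G; have [y1|y1] := eqVneq y z1; have [y2|y2] := eqVneq y z2 => /=; lia.
  by rewrite [f y]/f Jy /g /c -hp -hm; lra.
have := @lyapunov alive past_alive f g c N alive_decr f0 g0 c0 key.
have -> : f 0 = 0.
  by rewrite /f; case: ifP => // _; rewrite /h (_ : Num.max _ _ = 0)//; lia.
rewrite add0e.
have mA n : measurable (alive n) by exact: (measurable_alive past_alive).
have mout n : measurable [set w | ~~ J (S n.+1 w)].
  exact: (measurable_pred n.+1 (fun z => ~~ J z)).
have lhsE : (\sum_(n < N) \int[Q]_w (\1_(alive n) w * g (S n w))%:E =
    M%:E * \sum_(n < N) Q (alive n `&` [set w | ~~ J (S n.+1 w)]))%E.
  rewrite ge0_sume_distrr//; apply: eq_bigr => n _.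
  rewrite -(integral_step past_alive n e0).
  rewrite -(@integral_killed_cst (fun n => alive n `&` [set w | ~~ J (S n.+1 w)]))//; last first.
    exact: measurableI.
  apply: eq_integral => w _; congr EFin; rewrite !indicE in_setI /e.
  have [aw|] := boolP (w \in alive n); last by rewrite !mul0r.
  have [Jw|Jw] := boolP (J (S n.+1 w)).
    by rewrite memNset ?mulr0 ?mul0r//= Jw.
  by rewrite (mem_set (Jw : [set w | ~~ J (S n.+1 w)] w)).
rewrite lhsE => le1.
have rhs_le : (\sum_(n < N) \int[Q]_w (\1_(alive n) w * c (S n w))%:E <=
    (C * t + 1)%:E)%E.
  pose A z n := [set w | S n w = z] `&` [set w | T n w <= t].
  have mAz z n : measurable (A z n).
    apply: measurableI; first exact: measurable_chain.
    by apply: measurable_set_le => //; exact: measurable_time.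
  have visit z : 1 <= C * s z -> (\sum_(n < N) Q (A z n) <= (C * t + 1)%:E)%E.
    move=> Cz; apply: le_trans (visits_le N z (ltW t_gt0)) _.
    by rewrite lee_fin lerD2r ler_pdivrMr// mulrAC ler_peMl// ltW.
  apply: (@le_trans _ _ (\sum_(n < N) ((1 / 2)%:E * Q (A z1 n) +
      (1 / 2)%:E * Q (A z2 n)))%E).
    apply: lee_sum => n _.
    rewrite -!(@integral_killed_cst (A _) (1 / 2) n)//.
    have mhalf z : measurable_fun setT (fun w => (\1_(A z n) w * (1 / 2))%:E : \bar R).
      by apply/measurable_EFinP; apply: measurable_funM => //; exact: measurable_indic.
    rewrite -ge0_integralD//; try by move=> w _; rewrite lee_fin mulr_ge0.
    apply: ge0_le_integral => //.
    - by move=> w _; rewrite lee_fin mulr_ge0.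
    - by apply/measurable_EFinP; exact: (measurable_killed past_alive).
    - exact: emeasurable_funD.
    move=> w _; rewrite -EFinD lee_fin.
    rewrite indicE; case: (boolP (w \in alive n)) => [|_]; last first.
      by rewrite mul0r addr_ge0// mulr_ge0.
    rewrite inE mul1r => -[_ Tt].
    rewrite /c /G; have [S1|S1] := eqVneq (S n w) z1.
      rewrite [\1_(A z1 n) w]indicE mem_set; last by split.
      by rewrite mul1r lerDl mulr_ge0.
    have [S2|S2] := eqVneq (S n w) z2; last first.
      by rewrite mul0r mulr0 addr_ge0// mulr_ge0.
    rewrite [\1_(A z2 n) w]indicE mem_set; last by split.
    by rewrite mul1r lerDr mulr_ge0.
  rewrite big_split/= -!ge0_sume_distrr//.
  apply: (@le_trans _ _ ((1 / 2)%:E * (C * t + 1)%:E + (1 / 2)%:E * (C * t + 1)%:E)%E).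
    by apply: leeD; apply: lee_wpmul2l; rewrite ?lee_fin//; exact: visit.
  by rewrite -!EFinM -EFinD lee_fin; lra.
apply: le_trans rhs_le; apply: le_trans le1.
apply: lee_wpmul2l; rewrite ?lee_fin//.
apply: measure_bigsetU_seq_le => n; exact: measurableI.
Qed.

Let visit y n :=
  hit G n `&` [set w | S n w = y] `&` [set w | T n w <= t < T n.+1 w].

Let untrapped N := \big[setU/set0]_(y <- U) \big[setU/set0]_(n < N) visit y n.

Let measurable_visit n y : measurable (visit y n).
Proof.
apply: measurableI.
  by apply: measurableI; [exact: measurable_hit|exact: measurable_chain].
exact: measurable_sojourn.
Qed.

Let measurable_untrapped N : measurable (untrapped N).
Proof.
apply: bigsetU_measurable => y _; apply: bigsetU_measurable => n _.
exact: measurable_visit.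
Qed.

Let untrapped_le N : (Q (untrapped N) <= (C * Sig)%:E)%E.
Proof.
rewrite /Sig mulr_sumr -sumEFin.
apply: le_trans (measure_bigsetU_seq_le _ _ _) _.
  by move=> y; apply: bigsetU_measurable => n _; exact: measurable_visit.
rewrite big_seq [leRHS]big_seq; apply: lee_sum => y /GU nGy.
apply: le_trans (measure_bigsetU_seq_le _ _ _) _.
  by move=> n; exact: measurable_visit.
apply: occupation_le => // z /orP[]/eqP->//.
Qed.

(** Steps have size 1, so a walk started between [z2] and [z1] cannot pass either of them without
    landing on it. *)
Let stay_gap n w : ~ hit G n w -> stay gap n w.
Proof.
move=> nhit k; have notG j : (j <= n)%N -> ~~ G (S j w).
  by move=> jn; apply/negP => Gj; apply: nhit; exists j.
elim: k => [_|k IH kn].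
  by have := notG 0%N isT; rewrite /G /gap jump_chain0 => /norP[]; lia.
have := IH (ltnW kn); have := notG _ kn; rewrite /G /gap jump_chainS => /norP[].
by case: ifP; lia.
Qed.

Let gap_time_ge n N w : (n < N)%N -> stay gap n w -> T n.+1 w <= gap_time N w.
Proof.
move=> nN stw; rewrite /gap_time.
pose F k := \1_(stay gap k) w * s (S k w) * V (inr k) w.
rewrite -(big_mkord predT F) (@big_cat_nat _ _ _ n.+1)//= big_mkord.
rewrite -[leLHS]addr0; apply: lerD; last first.
  by apply: sumr_ge0 => k _; rewrite !mulr_ge0// ltW.
rewrite /jump_time le_eqVlt; apply/orP; left; apply/eqP.
apply: eq_bigr => k _; rewrite /F /hold_time indicE mem_set ?mul1r//.
by move=> j jk; apply: stw; apply: leq_trans jk _; rewrite -ltnS.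
Qed.

(** If the walk leaves [J] within [N] steps, consider its last position before doing so. Either that
    position is reached by time [t], which is [exit], or the sojourn containing [t] lies in [J].
    This sojourn is in [G], or off [G] after a hit, or before any hit; in the last case the gap time
    exceeds [t]. *)
Let localized N w : BTM_event s V t [set z1; z2] w \/ stay J N w \/ exit N w \/
  (t < gap_time N w)%R \/ untrapped N w.
Proof.
have [|/existsNP[k0]] := pselect (stay J N w); first by right; left.
move=> /not_implyP[k0N /negP nJk0].
have exJ : exists k, ~~ J (S k w) by exists k0.
case: (ex_minnP exJ) => -[|k] nJk kmin.
  by move: nJk; rewrite jump_chain0 /J; lia.
have kN : (k < N)%N by apply: leq_trans (kmin _ nJk0) k0N.
have Jk j : (j <= k)%N -> J (S j w).
  by move=> jk; apply/negPn/negP => /kmin; rewrite ltnNge jk.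
have [Tk|Tk] := leP (T k w) t.
  right; right; left; rewrite /exit.
  rewrite -(bigcup_mkord N (fun n => alive n `&` [set w | ~~ J (S n.+1 w)])).
  by exists k => //; exact: (conj (conj Jk Tk) nJk).
have exT : exists n, t < T n w by exists k.
case: (ex_minnP exT) => -[|n] Tn nmin.
  by move: Tn; rewrite time0 ltNge ltW.
have nk : (n < k)%N by exact: nmin.
have Tnt : T n w <= t by rewrite leNgt; apply/negP => /nmin; rewrite ltnn.
have nN : (n < N)%N by exact: ltn_trans kN.
have [Gn|nGn] := boolP (G (S n w)).
  left; exists n; split => //; split => //.
  by move: Gn => /orP[]/eqP->; [left|right].
have [hn|nhn] := pselect (hit G n w).
  do 4 right; rewrite /untrapped -bigcup_seq; exists (S n w).
    by apply: JU => //; apply: Jk; exact: ltnW.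
  rewrite -(bigcup_mkord N (visit (S n w))).
  exists n => //; split => //.
  by rewrite /= Tnt Tn.
do 3 right; left; apply: lt_le_trans Tn _.
by apply: gap_time_ge => //; exact: stay_gap.
Qed.

Lemma measurable_BTM_event (A : set int) : measurable (BTM_event s V t A).
Proof.
rewrite (_ : BTM_event s V t A = \bigcup_n
    ([set w | T n w <= t] `&` ([set w | t < T n.+1 w] `&` [set w | A (S n w)]))).
  apply: bigcupT_measurable => n; apply: measurableI.
    by apply: measurable_set_le => //; exact: measurable_time.
  apply: measurableI.
    by apply: measurable_set_lt => //; exact: measurable_time.
  apply: (past_measurable mV (J := before n)).
  exact: (past_chain_pred n A).
by rewrite predeqE => w; split => [[n h]|[n _ h]]; exists n.
Qed.

(** [rho] pays for the walk being still in [J] after [N] jumps; [N] can be taken as large as desired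
    because the other error terms do not depend on it. *)
Lemma localization rho : 0 < rho ->
  (1 <= Q (BTM_event s V t [set z1; z2]) +
    ((C * t + 1) / m.+1%:R + (z1 - z2)%:~R * Sig / t + C * Sig + rho)%:E)%E.
Proof.
move=> rho0.
set c := (z1 + m%:Z + 1)%:~R * (m%:Z - z2 + 1)%:~R : R.
have c0 : 0 <= c by rewrite mulr_ge0// ler0z; lia.
pose N := (Num.truncn (c / rho)).+1.
have cN : c / rho < N%:R by rewrite truncnS_gt.
have N0 : 0 < N%:R :> R by rewrite ltr0n.
have Q1 : (Q (stay J N) <= rho%:E)%E.
  have := confined N; rewrite -/c -lee_pdivlMl// => h; apply: le_trans h _.
  by rewrite -EFinM lee_fin mulrC ler_pdivrMr// mulrC -ler_pdivrMr// ltW.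
have Q2 : (Q (exit N) <= ((C * t + 1) / m.+1%:R)%:E)%E.
  by have := exit_le N; rewrite -lee_pdivlMl ?ltr0n// -EFinM mulrC.
have Q3 : (Q [set w | (t < gap_time N w)%R] <= ((z1 - z2)%:~R * Sig / t)%:E)%E.
  by have := trapped N; rewrite -lee_pdivlMl// -EFinM mulrC.
have mB := measurable_BTM_event [set z1; z2].
have m1 : measurable (stay J N).
  by apply: (past_measurable mV (J := before N)); exact: past_stay.
have m3 : measurable [set w | t < gap_time N w] by exact: measurable_set_lt.
have m34 := measurableU _ _ m3 (measurable_untrapped N).
have m234 := measurableU _ _ (measurable_exit N) m34.
have m1234 := measurableU _ _ m1 m234.
rewrite -(probability_setT Q).
apply: (@le_trans _ _ (Q (BTM_event s V t [set z1; z2] `|` (stay J N `|`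
    (exit N `|` ([set w | t < gap_time N w] `|` untrapped N)))))).
  apply: le_measure; rewrite ?inE//; first exact: measurableU.
  by move=> w _; exact: localized.
apply: le_trans (measureU2 _ mB m1234) _; apply: leeD => //.
apply: le_trans (measureU2 _ m1 m234) _.
apply: (@le_trans _ _ (rho%:E + (((C * t + 1) / m.+1%:R)%:E +
    (((z1 - z2)%:~R * Sig / t)%:E + (C * Sig)%:E)))%E).
  apply: leeD => //; apply: le_trans (measureU2 _ (measurable_exit N) m34) _.
  apply: leeD => //; apply: le_trans (measureU2 _ m3 (measurable_untrapped N)) _.
  by apply: leeD; [exact: Q3|exact: untrapped_le].
rewrite -!EFinD lee_fin.
by move: (_ / m.+1%:R) (_ / t) (C * Sig) => x y z; lra.
Qed.

End localization.

End walk.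

(** * Almost surely positive clocks *)

Section null_modification.
Context {d} {W : measurableType d} {R : realType} (Q : probability W R).

Lemma measure_le_null (A B N : set W) : measurable A -> measurable B ->
  measurable N -> Q N = 0%E -> A `<=` B `|` N -> (Q A <= Q B)%E.
Proof.
move=> mA mB mN QN AB; rewrite -[leRHS]adde0 -QN.
apply: le_trans (measureU2 _ mB mN); apply: le_measure; rewrite ?inE//.
exact: measurableU.
Qed.

Lemma measure_eq_null (A B N : set W) : measurable A -> measurable B ->
  measurable N -> Q N = 0%E -> (forall w, ~ N w -> A w <-> B w) -> Q A = Q B.
Proof.
move=> mA mB mN QN AB; apply/eqP; rewrite eq_le; apply/andP; split.
  apply: (measure_le_null mA mB mN QN) => w Aw.
  by have [|nN] := pselect (N w); [right|left; exact/(AB w nN)].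
apply: (measure_le_null mB mA mN QN) => w Bw.
by have [|nN] := pselect (N w); [right|left; exact/(AB w nN)].
Qed.

End null_modification.

Section BTM_localization.
Context {d} {W : measurableType d} {R : realType}.
Variables (Q : probability W R) (V : nat + nat -> W -> R).
Hypothesis QV : BTM_randomness Q V.

Let mV i : measurable_fun setT (V i). Proof. by case: QV. Qed.

(* The clocks are only almost surely positive; [Vp] makes them so everywhere. *)
Let pos_part (i : nat + nat) (x : R) : R :=
  if i is inr _ then (if 0 < x then x else 1) else x.

Let Vp i w := pos_part i (V i w).

Let mpos_part i : measurable_fun setT (pos_part i).
Proof.
case: i => [k|k]; rewrite /pos_part; first exact: measurable_id.
apply: measurable_fun_ifT => //; exact: measurable_fun_ltr.
Qed.

Let mVp i : measurable_fun setT (Vp i).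
Proof. exact: (measurableT_comp (@mpos_part i) (@mV i)). Qed.

Let indVp : mutually_independent Q Vp.
Proof.
move=> J B uJ mB; case: QV => _ [indV _].
apply: (indV J (fun j => pos_part j @^-1` B j) uJ) => j jJ.
exact: (measurable_preimageT (@mpos_part j) (mB j jJ)).
Qed.

(** Only the probabilities of the values 1 and -1 are given. They bound both the event and its
    complement below by 1/2, which forces equality. *)
Let stepVp n : Q [set w | 0 < Vp (inl n) w] = (1 / 2)%:E.
Proof.
case: QV => _ [_ [+ _]] => /(_ n)[h1 h2].
have mlt : measurable [set w | 0 < V (inl n) w] by exact: measurable_set_lt.
have meq a : measurable [set w | V (inl n) w = a].
  exact: (measurable_preimageT (@mV (inl n)) (measurable_set1 a)).
have ge : ((1 / 2)%:E <= Q [set w | (0 < V (inl n) w)%R])%E.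
  rewrite -h1; apply: le_measure; rewrite ?inE//.
  by move=> w /= ->.
have ge' : ((1 / 2)%:E <= Q (~` [set w | (0 < V (inl n) w)%R]))%E.
  rewrite -h2; apply: le_measure; rewrite ?inE//; first exact: measurableC.
  by move=> w /= ->; rewrite oppr_gt0 ltr10.
apply/eqP; rewrite eq_le ge andbT.
rewrite probability_setC// in ge'.
have := fin_num_measure Q _ mlt.
case: (Q [set w | (0 < V (inl n) w)%R]) ge' => // q.
by rewrite -EFinB !lee_fin => ? _; lra.
Qed.

Let bad n := [set w | V (inr n) w <= 0].

Let mbad n : measurable (bad n). Proof. exact: measurable_set_le. Qed.

Let bad0 n : Q (bad n) = 0%E.
Proof.
case: QV => _ [_ [_ /(_ n 0 (lexx 0))]]; rewrite oppr0 expR0 => h.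
rewrite (_ : bad n = ~` [set w | 0 < V (inr n) w]).
  by rewrite probability_setC ?h ?subee//; exact: measurable_set_lt.
by rewrite predeqE => w /=; split => [/le_gtF->//|/negP]; rewrite -leNgt.
Qed.

Let Vp_gt0 n w : 0 < Vp (inr n) w.
Proof. by rewrite /Vp /=; case: ifP. Qed.

Let tail_n n x : 0 <= x -> Q (Vp (inr n) @^-1` `]x, +oo[%classic) = (expR (- x))%:E.
Proof.
move=> x0; case: QV => _ [_ [_ /(_ n x x0)]] <-.
apply: (measure_eq_null (N := bad n)) => //.
- apply: (measurable_preimageT (@mVp (inr n))); exact: measurable_itv.
- exact: measurable_set_lt.
- by move=> w /negP; rewrite -ltNge => V0; rewrite /= in_itv/= andbT /Vp /= V0.
Qed.

Let clock_mixin n := isMeasurableFun.Build _ _ _ _ _ (@mVp (inr n)).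
Let clock n : {mfun W >-> R} := HB.pack (Vp (inr n)) (@clock_mixin n).
Let nu : probability R R := distribution Q (clock 0).

Let tail (x : R) : 0 <= x -> nu `]x, +oo[%classic = (expR (- x))%:E.
Proof. exact: tail_n. Qed.

Let lawVp n B : measurable B -> Q (Vp (inr n) @^-1` B) = nu B.
Proof.
move=> mB; apply: (@eq_law_of_tails _ (distribution Q (clock n)) nu) => // x.
have tn (y : R) : 0 <= y -> distribution Q (clock n) `]y, +oo[%classic = (expR (- y))%:E.
  exact: tail_n.
have [x0|/ltW x0] := leP 0 x; first exact: etrans (tn _ x0) (esym (tail x0)).
exact: etrans (exponential_tail_neg tn x0) (esym (exponential_tail_neg tail x0)).
Qed.

(** The bad clocks form a null set, so [Vp] and [V] give the event the same probability, and the
    [rho] of [localization] is arbitrary. *)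
Lemma BTM_localization (s : int -> R) (z1 z2 : int) (m : nat) (U : seq int)
    (t C : R) (A : set int) :
  (forall z, 0 < s z) -> 0 < z1 -> z2 <= 0 -> 0 < t -> 0 <= C ->
  1 <= C * s z1 -> 1 <= C * s z2 ->
  (forall z, (z2 - m%:Z <= z) && (z <= z1 + m%:Z) ->
     ~~ ((z == z1) || (z == z2)) -> z \in U) ->
  (forall z, z \in U -> ~~ ((z == z1) || (z == z2))) ->
  A z1 -> A z2 ->
  `|BTM_prob Q s V t A - 1| <= (C * t + 1) / m.+1%:R +
     (z1 - z2)%:~R * (\sum_(z <- U) s z) / t + C * (\sum_(z <- U) s z).
Proof.
move=> s0 z10 z20 t0 C0 Cz1 Cz2 JU GU Az1 Az2.
set err := _ + _ + _.
have chainE n w : jump_chain Vp n w = jump_chain V n w by [].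
have mA : measurable (BTM_event s V t A) by exact: measurable_BTM_event.
have mAp B : measurable (BTM_event s Vp t B) by exact: measurable_BTM_event.
have QE : Q (BTM_event s V t A) = Q (BTM_event s Vp t A).
  apply: (measure_eq_null (N := \bigcup_n bad n)) => //.
  - exact: bigcupT_measurable.
  - apply/negligibleP; first exact: bigcupT_measurable.
    by apply: negligible_bigcup => n; apply/negligibleP; [exact: mbad|exact: bad0].
  move=> w good.
  have VE n : Vp (inr n) w = V (inr n) w.
    rewrite /Vp /=; case: ltP => // h.
    by exfalso; apply: good; exists n.
  have timeE n : jump_time s Vp n w = jump_time s V n w.
    by apply: eq_bigr => k _; rewrite /hold_time VE.
  by split=> -[n h]; exists n; move: h; rewrite !timeE.
have le1 : 1 - err <= BTM_prob Q s V t A.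
  apply/ler_addgt0Pr => rho rho0.
  have := localization mVp indVp stepVp lawVp tail Vp_gt0 s0 z10 z20 t0 C0
    Cz1 Cz2 JU GU rho0.
  rewrite -/err => h.
  have : (1 <= Q (BTM_event s V t A) + (err + rho)%:E)%E.
    apply: le_trans h _; rewrite leeD2r// QE; apply: le_measure; rewrite ?inE//.
    by move=> w [n [h1 [h2 h3]]]; exists n; split => //; split => //; case: h3 => ->.
  rewrite -[Q _]fineK ?fin_num_measure// -EFinD lee_fin /BTM_prob.
  by move: (fine _) => q; lra.
have : BTM_prob Q s V t A <= 1.
  rewrite -lee_fin /BTM_prob fineK ?fin_num_measure//.
  exact: probability_le1.
by move=> le2; rewrite ler0_norm; lra.
Qed.

End BTM_localization.

(** * Slowly varying tails *)

Section tail_function.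
Context {R : realType}.
Variable p : R -> R.
Hypothesis p_noninc : forall x y, x <= y -> p y <= p x.
Hypothesis p_gt0 : forall x, 0 < p x.
Hypothesis p_le1 : forall x, p x <= 1.
Hypothesis p_slow : forall M eta : R, 0 < M -> 0 < eta ->
  exists2 X : R, 0 < X & forall u, X <= u -> p u <= (1 + eta) * p (u * M).

(** Induction on scales: a point beyond [2 * X] is brought into [[X, 2 * X]] by finitely many
    halvings. *)
Lemma dyadic_ind (X : R) (A : R -> Prop) : 0 < X ->
  (forall x, X <= x -> x <= 2 * X -> A x) ->
  (forall x, 2 * X <= x -> A (x / 2) -> A x) ->
  forall x, X <= x -> A x.
Proof.
move=> X0 base step x xX.
have [k] : exists k : nat, x <= 2 ^+ k * X.
  exists (Num.truncn (x / X)).+1; rewrite -ler_pdivrMr//.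
  apply: le_trans (ltW (truncnS_gt _)) _.
  by rewrite -natrX ler_nat ltnW// ltn_expl.
elim: k x xX => [|k IH] x xX xk.
  by apply: base => //; move: xk; rewrite expr0; lra.
have [x2|x2] := leP x (2 * X); first exact: base.
apply: step; first exact: ltW.
by apply: IH; move: xk; rewrite ?exprS; lra.
Qed.

Lemma half_tail eta : 0 < eta -> exists2 X : R, 0 < X &
  forall x, 2 * X <= x -> p (x / 2) <= (1 + eta) * p x.
Proof.
move=> eta0; have [X X0 hX] := p_slow (ltr0n R 2) eta0.
exists X => // x xX; have := hX (x / 2); rewrite divfK ?pnatr_eq0//.
by apply; lra.
Qed.

Lemma mass_unbounded B : exists2 X : R, 0 < X & forall x, X <= x -> B <= x * p x.
Proof.
have half0 : 0 < 2^-1 :> R by rewrite invr_gt0.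
have [X X0 hX] := half_tail half0.
pose c := X * p (2 * X); have c0 : 0 < c by rewrite mulr_gt0.
have grow x : 2 * X <= x -> (4 / 3) * (x / 2 * p (x / 2)) <= x * p x.
  move=> xX; have x0 : 0 < x by lra.
  have := hX x xX; move: (p_gt0 x) (p_gt0 (x / 2)); nra.
have base x : X <= x -> c <= x * p x.
  move: x; apply: dyadic_ind => // x xX.
    by move=> x2; apply: ler_pM => //; [exact: ltW|exact: ltW|exact: p_noninc].
  by move=> h; apply: le_trans (grow _ xX); move: c0 h; lra.
have pow k x : 2 ^+ k * X <= x -> (4 / 3) ^+ k * c <= x * p x.
  elim: k x => [|k IH] x; first by rewrite !expr0 !mul1r; exact: base.
  rewrite !exprS => xk.
  have k1 : 1 <= 2 ^+ k :> R by rewrite exprn_ege1// ler1n.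
  have x2 : 2 * X <= x by nra.
  apply: le_trans (grow _ x2); rewrite -mulrA ler_pM2l; last by lra.
  by apply: IH; lra.
(* After [k.+1] doublings Bernoulli's inequality gives a factor of at least [1 + k.+1 / 3], which
   beats [B / c]. *)
pose k := Num.truncn (3 * B / c).
exists (2 ^+ k.+1 * X); first by rewrite mulr_gt0// exprn_gt0.
move=> x /pow; apply: le_trans.
have bern n : 1 + n%:R / 3 <= (4 / 3) ^+ n :> R.
  elim: n => [|n IH]; first by rewrite expr0; lra.
  have n0 : 0 <= n%:R :> R by [].
  by rewrite exprS -natr1; nra.
have : 3 * B / c < k.+1%:R by exact: truncnS_gt.
rewrite ltr_pdivrMr// => h.
apply: (@le_trans _ _ ((1 + k.+1%:R / 3) * c)); last by rewrite ler_pM2r.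
by move: h c0; move: (k.+1%:R) => y; nra.
Qed.

(** Meant for truncated means, with [X] uniform over the sites [z]. Each dyadic shell adds at most a
    fraction [eta] of [x * p x], which itself grows geometrically, so the sum over the shells is of
    the order of the last one. *)
Lemma karamata {T : Type} (mu : T -> R -> R) :
  (forall z x, 0 <= x -> mu z x <= x) ->
  (forall z x, 0 <= x -> mu z x <= mu z (x / 2) + x * (p (x / 2) - p x)) ->
  forall theta, 0 < theta -> exists2 X : R, 0 < X &
    forall z x, X <= x -> mu z x <= theta * (x * p x).
Proof.
move=> mu_le mu_half theta theta0.
pose eta := Num.min (theta / 8) 2^-1.
have eta0 : 0 < eta by rewrite lt_min invr_gt0 divr_gt0//=.
have eta1 : eta <= 2^-1 by rewrite ge_min lexx orbT.
have eta8 : eta <= theta / 8 by rewrite ge_min lexx.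
have [X X0 hX] := half_tail eta0.
(* The constant 4 reproduces itself: halving [x] turns it into at most 3, as [p (x / 2)] is at most
   3/2 of [p x], and the new shell adds 1. *)
have bound z x : X <= x -> mu z x <= 2 * X + 4 * eta * (x * p x).
  move: x; apply: dyadic_ind => // x xX.
    move=> x2; have x0 : 0 <= x by lra.
    have := mu_le z x x0; have := mulr_ge0 x0 (ltW (p_gt0 x)).
    by move: (x * p x) => y; nra.
  have x0 : 0 < x by lra.
  move=> IH; have := mu_half z x (ltW x0); have := hX x xX.
  move: (p_gt0 x) (p_gt0 (x / 2)) IH.
  move: (p x) (p (x / 2)) (mu z x) (mu z (x / 2)) => a b c e a0 b0 ce ba ec.
  have h1 : x * b <= x * ((1 + eta) * a) by rewrite ler_pM2l.
  have h2 : x * b <= 3 / 2 * (x * a).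
    apply: le_trans h1 _; rewrite mulrCA ler_pM2r ?mulr_gt0//; lra.
  have h3 : eta * (x * b) <= eta * (3 / 2 * (x * a)) by rewrite ler_pM2l.
  by move: ce ec h1 h3; lra.
(* Beyond [Y] the constant [2 * X] uses up half of [theta]; the term with [4 * eta] uses the other
   half. *)
have [Y Y0 hY] := mass_unbounded (4 * X / theta).
exists (Num.max X Y); first by rewrite lt_max X0.
move=> z x; rewrite ge_max => /andP[xX xY].
have := hY x xY; rewrite ler_pdivrMr// => h.
have xp0 : 0 <= x * p x by rewrite mulr_ge0 ?ltW// (lt_le_trans X0).
have := bound z x xX; move: h xp0 eta8; move: (x * p x) => y; nra.
Qed.

Let E t : set R := [set s | 0 <= s /\ t <= s * (p s)^-1].
Let l t := inf (E t).

Let E_neq0 t : E t !=set0.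
Proof.
exists (Num.max t 0); split; first by rewrite le_max lexx orbT.
have m0 : 0 <= Num.max t 0 by rewrite le_max lexx orbT.
apply: (@le_trans _ _ (Num.max t 0)); first by rewrite le_max lexx.
by rewrite ler_peMr// invf_ge1.
Qed.

Let E_lb t : has_lbound (E t). Proof. by exists 0 => s []. Qed.

Let ratio_mono x y : 0 <= x -> x <= y -> x * (p x)^-1 <= y * (p y)^-1.
Proof.
by move=> x0 xy; apply: ler_pM => //; rewrite ?invr_ge0 ?(ltW (p_gt0 _))// lef_pV2
  ?posrE// p_noninc.
Qed.

Lemma ell_large X : 0 <= X -> exists T, forall t, T <= t -> X <= l t.
Proof.
move=> X0; exists (X * (p X)^-1 + 1) => t tX.
apply: lb_le_inf => // s [s0 ts].
rewrite leNgt; apply/negP => /ltW sX.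
by have := ratio_mono s0 sX; lra.
Qed.

(** [l t] is an infimum at which [s / p s] may jump across [t]. So [t] is compared at [2 * l t],
    above the infimum, and at [l t / 2], below it; passing back to [p (l t)] costs a further factor
    2 each time, whence 4. *)
Lemma ell_balance : exists T, forall t, T <= t ->
  t * p (l t) <= 4 * l t /\ l t <= 4 * (t * p (l t)).
Proof.
have [X X0 hX] := half_tail (@ltr01 R).
have X20 : 0 <= 2 * X by lra.
have [T hT] := ell_large X20.
exists T => t /hT lX; have l0 : 0 < l t by lra.
split.
  have : t <= 2 * l t * (p (2 * l t))^-1.
    have [|s [s0 ts] sl] := @inf_lt _ (E t) (2 * l t) (E_neq0 t).
      by rewrite -/(l t); lra.
    by apply: le_trans ts (ratio_mono s0 (ltW sl)).
  rewrite -ler_pdivrMr ?invr_gt0// invrK => h.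
  have := hX (2 * l t); rewrite (_ : 2 * l t / 2 = l t); last by field.
  have l2 : 2 * X <= 2 * l t by lra.
  move=> /(_ l2) h2; have [t0|t0] := leP t 0.
    by apply: (@le_trans _ _ 0); [rewrite pmulr_lle0|lra].
  have : t * p (l t) <= t * ((1 + 1) * p (2 * l t)) by rewrite ler_pM2l.
  by move: h; lra.
have : l t / 2 * (p (l t / 2))^-1 <= t.
  rewrite leNgt; apply/negP => /ltW h.
  have : l t <= l t / 2.
    by apply: ge_inf => //; split => //; lra.
  lra.
rewrite ler_pdivrMr// => h.
have t0 : 0 < t.
  by rewrite -(pmulr_lgt0 _ (p_gt0 (l t / 2))); apply: lt_le_trans h; lra.
have : t * p (l t / 2) <= t * ((1 + 1) * p (l t)) by rewrite ler_pM2l// hX.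
by move: h; lra.
Qed.

End tail_function.

(** * The environment *)

Definition window (k : nat) : seq int :=
  [seq (i%:Z - k%:Z)%R | i <- iota 0 (2 * k + 1)].

Lemma mem_window k (y : int) : (y \in window k) = (- k%:Z <= y) && (y <= k%:Z).
Proof.
apply/idP/idP => [/mapP[i]|/andP[y1 y2]]; first by rewrite mem_iota; lia.
apply/mapP; exists (absz (y + k%:Z)); last by lia.
by rewrite mem_iota; lia.
Qed.

(** The deterministic part. Between [z1] and [z2] sites are shallow by minimality; on the two flanks
    of length [m] they are shallow because no two deep sites of the window are that close. The empty
    band makes deep sites deeper than [M * l]. *)
Lemma first_sites {R : realType} (s : int -> R) (l M theta : R) (n m : nat) :
  (forall z, 0 < s z) ->
  (exists2 i, (i < n)%N & l < s i.+1%:Z) ->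
  (exists2 i, (i < n)%N & l < s (- i%:Z)) ->
  (forall y, y \in window (n + m) -> ~ (l < s y <= M * l)) ->
  (forall y, y \in window (n + m) -> forall i, (i < m)%N ->
     ~ (l < s y /\ l < s (y + i.+1%:Z))) ->
  \sum_(y <- window (n + m)) s y * (s y <= l)%R%:R <= theta * l ->
  exists z1 z2 : int, exists U : seq int,
    [/\ [/\ 0 < z1, z2 <= 0 & z1 - z2 <= 2 * n%:Z],
        [/\ l < s z1, M * l < s z1 & forall y, 0 < y -> y < z1 -> s y <= l],
        [/\ l < s z2, M * l < s z2 & forall y, z2 < y -> y <= 0 -> s y <= l],
        (forall z, (z2 - m%:Z <= z) && (z <= z1 + m%:Z) ->
          ~~ ((z == z1) || (z == z2)) -> z \in U) /\
        (forall z, z \in U -> ~~ ((z == z1) || (z == z2))) &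
        \sum_(z <- U) s z <= theta * l].
Proof.
move=> s0 [i0 i0n si0] [j0 j0n sj0] band pair mass.
have exi : exists i, l < s i.+1%:Z by exists i0.
have exj : exists j, l < s (- j%:Z) by exists j0.
case: (ex_minnP exi) => i si imin; case: (ex_minnP exj) => j sj jmin.
have iN : (i < n)%N := leq_ltn_trans (imin _ si0) i0n.
have jN : (j < n)%N := leq_ltn_trans (jmin _ sj0) j0n.
have below1 (y : int) : 0 < y -> y < i.+1%:Z -> s y <= l.
  move=> y0 yi; rewrite leNgt; apply/negP => ly.
  have [k yk] : exists k : nat, y = k.+1%:Z by exists (absz y).-1; lia.
  by rewrite yk in ly yi; have := imin _ ly; lia.
have below2 (y : int) : - j%:Z < y -> y <= 0 -> s y <= l.
  move=> yj y0; rewrite leNgt; apply/negP => ly.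
  have [k yk] : exists k : nat, y = - k%:Z by exists (absz y); lia.
  by rewrite yk in ly yj; have := jmin _ ly; lia.
have deep y : y \in window (n + m) -> l < s y -> M * l < s y.
  by move=> yw ly; rewrite ltNge; apply/negP => h; apply: (band y yw); rewrite ly.
have w1 : i.+1%:Z \in window (n + m) by rewrite mem_window; lia.
have w2 : - j%:Z \in window (n + m) by rewrite mem_window; lia.
pose near (y : int) := (- j%:Z - m%:Z <= y) && (y <= i.+1%:Z + m%:Z).
pose off (y : int) := ~~ ((y == i.+1%:Z) || (y == - j%:Z)).
have near_le y : near y && off y -> s y <= l.
  move=> /andP[/andP[y1 y2] /norP[y3 y4]].
  have [yi|yi] := ltP (i.+1%:Z) y.
    rewrite leNgt; apply/negP => ly.
    have km : ((absz (y - i.+1%:Z)).-1 < m)%N by lia.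
    apply: (pair _ w1 _ km); split => //.
    by rewrite (_ : i.+1%:Z + _ = y)//; lia.
  have [yj|yj] := ltP y (- j%:Z).
    rewrite leNgt; apply/negP => ly.
    have km : ((absz (- j%:Z - y)).-1 < m)%N by lia.
    have yw : y \in window (n + m) by rewrite mem_window; lia.
    apply: (pair _ yw _ km); split => //.
    by rewrite (_ : y + _ = - j%:Z)//; lia.
  by have [y0|y0] := ltP 0 y; [apply: below1; lia|apply: below2; lia].
exists (i.+1%:Z), (- j%:Z), [seq y <- window (n + m) | near y && off y].
split.
- by split; lia.
- by split => //; exact: deep.
- by split => //; exact: deep.
- split=> z; last by rewrite mem_filter => /andP[/andP[]].
  move=> nz oz; rewrite mem_filter /near nz /off oz/=.
  by rewrite mem_window; move: nz => /andP[]; lia.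
apply: le_trans mass; rewrite big_filter big_mkcond; apply: ler_sum => y _.
case: ifP => [/near_le ->|_]; first by rewrite mulr1.
by rewrite mulr_ge0// ltW.
Qed.

Section environment.
Context {d} {Omega : measurableType d} {R : realType}.
Variables (P : probability Omega R) (sig : int -> Omega -> R).
Hypothesis msig : forall z, measurable_fun setT (sig z).
Hypothesis ind : mutually_independent P sig.
Hypothesis idd : identically_distributed P sig.
Hypothesis sig_gt0 : forall z w, 0 < sig z w.
Hypothesis sv : slowly_varying (Ltail P sig).

Definition tailp (x : R) : R := fine (P [set w | x < sig 0 w]).

Lemma measurable_deep z x : measurable [set w | x < sig z w].
Proof. exact: measurable_set_lt. Qed.

Lemma tailpE z x : P [set w | x < sig z w] = (tailp x)%:E.
Proof.
rewrite /tailp fineK ?fin_num_measure//; last exact: measurable_deep.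
have rayE y : [set w | x < sig y w] = sig y @^-1` `]x, +oo[%classic.
  by rewrite predeqE => w /=; rewrite in_itv/= andbT.
by rewrite !rayE; apply: idd; exact: measurable_itv.
Qed.

Lemma tailp_noninc x y : x <= y -> tailp y <= tailp x.
Proof.
move=> xy; rewrite -lee_fin -!(tailpE 0); apply: le_measure; rewrite ?inE//;
  try exact: measurable_deep.
by move=> w /=; exact: le_lt_trans.
Qed.

Lemma tailp_ge0 x : 0 <= tailp x.
Proof. by rewrite /tailp fine_ge0. Qed.

Lemma tailp_le1 x : tailp x <= 1.
Proof. by rewrite -lee_fin -(tailpE 0); apply: probability_le1; exact: measurable_deep. Qed.

Lemma sv_eventually (M eta : R) : 0 < M -> 0 < eta -> exists X : R, forall u, X < u ->
  `|1 - (tailp (u * M))^-1 / (tailp u)^-1| <= eta.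
Proof.
move=> M0 eta0; have /cvgrPdist_le /(_ _ eta0) := sv M0.
by move=> [X [_ hX]]; exists X => u /hX.
Qed.

(** Inversion sends 0 to 0, so a vanishing tail would make the ratio of [Ltail] equal to 0
    arbitrarily far out instead of close to 1. *)
Lemma tailp_gt0 x : 0 < tailp x.
Proof.
have half0 : 0 < 2^-1 :> R by rewrite invr_gt0.
have [X hX] := sv_eventually (@ltr01 R) half0.
pose u := Num.max x X + 1.
have Xu : X < u by rewrite ltr_pwDr// le_max lexx orbT.
apply: (@lt_le_trans _ _ (tailp u)); last first.
  by apply: tailp_noninc; rewrite ler_wpDr// le_max lexx.
rewrite lt_neqAle tailp_ge0 andbT eq_sym; apply/eqP => pu.
have := hX u Xu; rewrite mulr1 pu invr0 mul0r subr0 normr1.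
by rewrite leNgt invf_lt1 ?ltr1n.
Qed.

Lemma tailp_slow (M eta : R) : 0 < M -> 0 < eta ->
  exists2 X : R, 0 < X & forall u, X <= u -> tailp u <= (1 + eta) * tailp (u * M).
Proof.
move=> M0 eta0; have [X hX] := sv_eventually M0 eta0.
exists (Num.max X 0 + 1); first by rewrite ltr_wpDl// le_max lexx orbT.
move=> u Xu; have : X < u.
  by apply: lt_le_trans Xu; rewrite ltr_pwDr// le_max lexx.
move=> /hX; rewrite invrK ler_distlC => /andP[_].
by rewrite mulrC ler_pdivrMr ?tailp_gt0.
Qed.

Lemma tailp_small eta : 0 < eta -> exists X : R, forall x, X <= x -> tailp x <= eta.
Proof.
move=> eta0.
pose X_mixin := isMeasurableFun.Build _ _ _ _ _ (@msig 0).
pose X : {RV P >-> R} := HB.pack (sig 0) X_mixin.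
have /fine_cvg /cvgrPdist_le /(_ _ eta0) := cvg_ccdfy0 X.
move=> [Y [_ hY]]; exists (Y + 1) => x xY.
have : Y < x by apply: lt_le_trans xY; rewrite ltrDl.
move=> /hY /=; rewrite sub0r normrN ger0_norm ?fine_ge0//.
apply: le_trans; rewrite /tailp /ccdf /distribution /pushforward.
rewrite (_ : _ @^-1` _ = [set w | x < sig 0 w])//.
by rewrite predeqE => w /=; rewrite in_itv/= andbT.
Qed.

Lemma measurable_band z x y : measurable [set w | x < sig z w <= y].
Proof. exact: measurable_set_oc. Qed.

Lemma bandE z x y : x <= y ->
  P [set w | x < sig z w <= y] = (tailp x - tailp y)%:E.
Proof.
move=> xy.
have -> : [set w | x < sig z w <= y] = [set w | x < sig z w] `\` [set w | y < sig z w].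
  rewrite predeqE => w /=; split => [/andP[-> h]|[-> /negP]]; last by rewrite -leNgt.
  by split => //; apply/negP; rewrite -leNgt.
rewrite measureD; [|exact: measurable_deep..|by rewrite ltey_eq fin_num_measure//;
  exact: measurable_deep].
rewrite setIidr; last by move=> w /=; exact: le_lt_trans.
by rewrite EFinB; congr (_ - _)%E; exact: tailpE.
Qed.

Lemma shallowE z x : P (sig z @^-1` `]-oo, x]%classic) = (1 - tailp x)%:E.
Proof.
have -> : sig z @^-1` `]-oo, x]%classic = ~` [set w | x < sig z w].
  by rewrite predeqE => w /=; rewrite in_itv/=; split => [/le_gtF/negP//|/negP];
    rewrite -leNgt.
by rewrite probability_setC ?tailpE//; exact: measurable_deep.
Qed.

(** By independence the probability is [(1 - q) ^+ n], and [(1 - q) ^+ n * (1 + n * q) <= 1] follows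
    by induction. The product form spares a case for [n = 0]. *)
Lemma no_deep_le (f : nat -> int) (n : nat) l : injective f ->
  (P (\bigcap_(z in [set z | z \in [seq f i | i <- iota 0 n]])
     sig z @^-1` `]-oo, l]%classic) * (n%:R * tailp l)%:E <= 1)%E.
Proof.
move=> finj; set J := [seq f i | i <- iota 0 n].
have uJ : uniq J by rewrite map_inj_uniq ?iota_uniq.
have -> := @ind J (fun=> `]-oo, l]%classic) uJ (fun _ _ => measurable_itv _).
have -> : (\prod_(j <- J) P (sig j @^-1` `]-oo, l]%classic) = ((1 - tailp l) ^+ n)%:E)%E.
  rewrite -[in RHS](size_iota 0 n) -(size_map f) -/J; elim: J {uJ} => [|z J IH].
    by rewrite big_nil.
  by rewrite big_cons IH shallowE -EFinM exprS.
rewrite -EFinM lee_fin.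
have q0 := tailp_gt0 l; have q1 := tailp_le1 l; move: (tailp l) q0 q1 => q q0 q1.
suff : (1 - q) ^+ n * (1 + n%:R * q) <= 1.
  have q10 : 0 <= 1 - q by rewrite subr_ge0.
  have := exprn_ge0 n q10.
  by move: (_ ^+ n) (n%:R) => x y; lra.
elim: n {J uJ} => [|n IH]; first by rewrite expr0 mul0r addr0 mulr1.
apply: le_trans IH; rewrite exprSr -mulrA ler_wpM2l ?exprn_ge0 ?subr_ge0//.
by rewrite -natr1; have : 0 <= n%:R :> R by []; nra.
Qed.

Lemma pair_le y z l : y != z ->
  P ([set w | l < sig y w] `&` [set w | l < sig z w]) = (tailp l ^+ 2)%:E.
Proof.
move=> yz; have uJ : uniq [:: y; z] by rewrite /= inE yz.
have := @ind [:: y; z] (fun=> `]l, +oo[%classic) uJ (fun _ _ => measurable_itv _).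
have rayE x : sig x @^-1` `]l, +oo[%classic = [set w | l < sig x w].
  by rewrite predeqE => w /=; rewrite in_itv/= andbT.
rewrite !big_cons big_nil mule1 !rayE !tailpE -EFinM expr2 => <-.
congr (P _); rewrite predeqE => w; split => [[yw zw] x /=|h].
  by rewrite in_itv/= andbT !inE => /orP[]/eqP->.
have hx x : x \in [:: y; z] -> l < sig x w.
  by move=> xyz; have := h x xyz; rewrite /= in_itv/= andbT.
by split; apply: hx; rewrite !inE eqxx ?orbT.
Qed.

Let trunc z x w := sig z w * (sig z w <= x)%R%:R.

Let mtrunc z x : measurable_fun setT (trunc z x).
Proof.
apply: measurable_funM => //.
rewrite (_ : (fun _ => _) = \1_[set w | sig z w <= x]).
  by apply: measurable_indic; exact: measurable_set_le.
by apply/funext => w; rewrite indicE; congr (nat_of_bool _)%:R; apply/idP/idP; rewrite inE.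
Qed.

Let trunc_ge0 z x w : 0 <= trunc z x w.
Proof. by rewrite mulr_ge0// ltW. Qed.

Let trunc_le z x w : 0 <= x -> trunc z x w <= x.
Proof.
by move=> x0; rewrite /trunc; have [h|h] := leP (sig z w) x; rewrite ?mulr1 ?mulr0.
Qed.

Definition trunc_mean z x : R :=
  fine (\int[P]_w (sig z w * (sig z w <= x)%R%:R)%:E)%E.

Lemma trunc_meanE z x : 0 <= x ->
  (\int[P]_w (sig z w * (sig z w <= x)%R%:R)%:E = (trunc_mean z x)%:E)%E.
Proof.
move=> x0; rewrite /trunc_mean fineK// ge0_fin_numE; last first.
  by apply: integral_ge0 => w _; rewrite lee_fin trunc_ge0.
apply: (@le_lt_trans _ _ (\int[P]_w x%:E)%E); last first.
  by rewrite integral_cst// [X in (_ * X)%E]probability_setT mule1 ltry.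
apply: ge0_le_integral => //.
- by move=> w _; rewrite lee_fin trunc_ge0.
- exact/measurable_EFinP/mtrunc.
- by move=> w _; rewrite lee_fin trunc_le.
Qed.

Lemma trunc_mean_le z x : 0 <= x -> trunc_mean z x <= x.
Proof.
move=> x0; rewrite -lee_fin -trunc_meanE//.
apply: (@le_trans _ _ (\int[P]_w x%:E)%E); last first.
  by rewrite integral_cst// [X in (_ * X)%E]probability_setT mule1.
apply: ge0_le_integral => //.
- by move=> w _; rewrite lee_fin trunc_ge0.
- exact/measurable_EFinP/mtrunc.
- by move=> w _; rewrite lee_fin trunc_le.
Qed.

(** Truncating at [x / 2] loses only the depths in []x / 2, x]], each at most [x]. This is the shell
    hypothesis of [karamata]. *)
Lemma trunc_mean_half z x : 0 <= x ->
  trunc_mean z x <= trunc_mean z (x / 2) + x * (tailp (x / 2) - tailp x).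
Proof.
move=> x0; have x20 : 0 <= x / 2 by rewrite divr_ge0.
have x2x : x / 2 <= x by lra.
rewrite -lee_fin EFinD EFinM -!trunc_meanE// -(bandE z x2x).
rewrite -(@integral_killed_cst _ _ _ P (fun=> [set w | x / 2 < sig z w <= x]) x 0%N)//;
  last exact: measurable_band.
rewrite -ge0_integralD//; last 4 first.
- by move=> w _; rewrite lee_fin trunc_ge0.
- exact/measurable_EFinP/mtrunc.
- by move=> w _; rewrite lee_fin mulr_ge0.
- apply/measurable_EFinP; apply: measurable_funM => //; apply: measurable_indic.
  exact: measurable_band.
apply: ge0_le_integral => //.
- by move=> w _; rewrite lee_fin trunc_ge0.
- exact/measurable_EFinP/mtrunc.
- apply/measurable_EFinP; apply: measurable_funD; first exact: mtrunc.
  apply: measurable_funM => //; apply: measurable_indic; exact: measurable_band.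
move=> w _; rewrite -EFinD lee_fin indicE.
have [h|h] := leP (sig z w) x; last first.
  by rewrite mulr0 addr_ge0 ?trunc_ge0// mulr_ge0.
have [h2|h2] := leP (sig z w) (x / 2); first by rewrite lerDl mulr_ge0.
by rewrite mem_set/= ?h2 ?h// mulr0 mulr1 add0r mul1r.
Qed.

Lemma mass_le (r : seq int) (a c l : R) : 0 < a -> 0 <= l ->
  (forall y, trunc_mean y l <= c) ->
  (a%:E * P [set w | (a < \sum_(y <- r) sig y w * (sig y w <= l)%R%:R)%R] <=
   ((size r)%:R * c)%:E)%E.
Proof.
move=> a0 l0 mc.
have mS : measurable_fun setT (fun w => \sum_(y <- r) sig y w * (sig y w <= l)%R%:R).
  by apply: measurable_sum => y; exact: mtrunc.
pose A := [set w | (a < \sum_(y <- r) sig y w * (sig y w <= l)%R%:R)%R].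
have mA : measurable A by exact: measurable_set_lt.
rewrite -/A -(@integral_killed_cst _ _ _ P (fun=> A) a 0%N)//; last exact: ltW.
apply: (@le_trans _ _ (\int[P]_w (\sum_(y <- r) sig y w * (sig y w <= l)%R%:R)%:E)%E).
  apply: ge0_le_integral => //.
  - by move=> w _; rewrite lee_fin mulr_ge0// ltW.
  - apply/measurable_EFinP; apply: measurable_funM => //; exact: measurable_indic.
  - exact/measurable_EFinP.
  move=> w _; rewrite lee_fin indicE; case: (boolP (w \in A)) => [|_].
    by rewrite inE mul1r => /ltW.
  by rewrite mul0r; apply: sumr_ge0 => y _; exact: trunc_ge0.
under eq_integral do rewrite -sumEFin.
rewrite ge0_integral_sum//; last 2 first.
- by move=> y; exact/measurable_EFinP/mtrunc.
- by move=> y w _; rewrite lee_fin trunc_ge0.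
rewrite (eq_bigr (fun y => (trunc_mean y l)%:E)) => [|y _]; last exact: trunc_meanE.
rewrite sumEFin lee_fin mulr_natl.
elim: r {mS A mA} => [|y r IH]; first by rewrite big_nil.
by rewrite big_cons mulrS lerD.
Qed.

End environment.

(** * The localisation theorem *)

Section joint_measurability.
Context {d} {Omega : measurableType d} {dW} {W : measurableType dW} {R : realType}.
Variables (sig : int -> Omega -> R) (Q : probability W R) (V : nat + nat -> W -> R).
Hypothesis msig : forall z, measurable_fun setT (sig z).
Hypothesis mV : forall i, measurable_fun setT (V i).

(** For each landscape the event is a section of one jointly measurable subset of [Omega * W], and
    the measure of a section is measurable. *)
Lemma measurable_BTM_prob (t : R) (A : Omega -> set int) :
  (forall z, measurable [set w | A w z]) ->
  measurable_fun setT (fun w => BTM_prob Q (fun z => sig z w) V t (A w)).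
Proof.
move=> mA.
pose V' i (p : (Omega * W)%type) := V i p.2.
have mV' i : measurable_fun setT (V' i).
  exact: (measurableT_comp (mV i) measurable_snd).
pose jt n (p : (Omega * W)%type) :=
  \sum_(k < n) sig (jump_chain V' k p) p.1 * V' (inr (k : nat)) p.
have mjt n : measurable_fun setT (jt n).
  apply: (measurable_holding_sum (s := fun z p => sig z p.1)) => // z.
  exact: (@measurable_comp_fst _ _ _ Omega W R _ (msig z)).
pose D : set (Omega * W)%type := \bigcup_n (([set p | jt n p <= t] `&`
  [set p | t < jt n.+1 p]) `&`
  \bigcup_(z : int) ([set p | jump_chain V' n p = z] `&` [set p | A p.1 z])).
have mD : measurable D.
  apply: bigcupT_measurable => n; apply: measurableI.
    by apply: measurableI; [exact: measurable_set_le|exact: measurable_set_lt].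
  apply: countable_bigcupT_measurable => [|z]; first exact: countableP.
  apply: measurableI; last exact: (@measurable_set_fst _ _ Omega W _ (mA z)).
  by apply: measurable_jump_chain => k _; exact: mV'.
have := measurable_fun_xsection Q mD.
move=> /(measurableT_comp (fine_measurable measurableT)).
apply: eq_measurable_fun => w _ /=; rewrite /BTM_prob; congr (fine (Q _)).
rewrite predeqE => w'; rewrite /xsection /= inE; split.
  move=> [n _ [[h1 h2] [z _ [h3 h4]]]]; exists n; split; first exact: h1.
  by split; [exact: h2|move: h4; rewrite -h3].
move=> [n [h1 [h2 h3]]]; exists n => //; split; first by split.
by exists (jump_chain V n w').
Qed.

End joint_measurability.

Section main_bound.
Context {d} {Omega : measurableType d} {dW} {W : measurableType dW} {R : realType}.
Variables (P : probability Omega R) (sig : int -> Omega -> R).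
Variables (Q : probability W R) (V : nat + nat -> W -> R).
Hypothesis msig : forall z, measurable_fun setT (sig z).
Hypothesis ind : mutually_independent P sig.
Hypothesis idd : identically_distributed P sig.
Hypothesis sig_gt0 : forall z w, 0 < sig z w.
Hypothesis sv : slowly_varying (Ltail P sig).
Hypothesis QV : BTM_randomness Q V.

Lemma measurable_Gamma t z : measurable [set w | Gamma P sig t w z].
Proof.
pose l := ell P sig t.
have mdeep y : measurable [set w | l < sig y w] by exact: measurable_set_lt.
have mall (q : pred int) : measurable [set w | forall y, q y -> sig y w <= l].
  rewrite (_ : [set _ | _] =
      ~` \bigcup_(y : int) (if q y then [set w | l < sig y w] else set0)).
    apply: measurableC; apply: countable_bigcupT_measurable => [|y].
      exact: countableP.
    by case: ifP.
  rewrite predeqE => w; split => [h [y _]|h y qy].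
    by case: ifPn => // /h /= h1; rewrite ltNge h1.
  rewrite leNgt; apply/negP => ly; apply: h; exists y => //.
  by rewrite qy.
apply: measurableU.
- rewrite [X in measurable X](_ : _ = if 0 < z then [set w | l < sig z w] `&`
      [set w | forall y, (0 < y) && (y < z) -> sig y w <= l] else set0).
    by case: ifP => // _; apply: measurableI => //; exact: (mall (fun y => (0 < y) && (y < z))).
  rewrite predeqE => w; case: ifPn => z0; split => //=.
  + by move=> [_ [h1 h2]]; split => // y /andP[]; exact: h2.
  + by move=> [h1 h2]; split => //; split => // y y0 yz; apply: h2; rewrite y0.
  + by move=> [z1]; rewrite z1 in z0.
- rewrite [X in measurable X](_ : _ = if z <= 0 then [set w | l < sig z w] `&`
      [set w | forall y, (z < y) && (y <= 0) -> sig y w <= l] else set0).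
    by case: ifP => // _; apply: measurableI => //; exact: (mall (fun y => (z < y) && (y <= 0))).
  rewrite predeqE => w; case: ifPn => z0; split => //=.
  + by move=> [_ [h1 h2]]; split => // y /andP[]; exact: h2.
  + by move=> [h1 h2]; split => //; split => // y y0 yz; apply: h2; rewrite y0.
  + by move=> [z1]; rewrite z1 in z0.
Qed.

Lemma measurable_target eps t : measurable [set w | eps <
  `| BTM_prob Q (fun z => sig z w) V t (Gamma P sig t w) - 1 |].
Proof.
apply: measurable_set_lt => //; apply: measurableT_comp => //.
apply: measurable_funB => //; apply: measurable_BTM_prob => //.
  by case: QV.
exact: measurable_Gamma.
Qed.

(** Here [q] is the tail at [l], [n1] and [m1] stand for [n] and [m.+1], [D] for [z1 - z2], and [S]
    for the total shallow depth. The first term takes half of [eps], the other two a quarter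
    each. *)
Lemma error_le (t l q M theta delta K eps S n1 m1 D : R) :
  0 < t -> 0 < l -> 0 < q -> 1 <= M -> 0 < theta -> 0 < delta -> 0 < K -> 0 < m1 ->
  t * q <= 4 * l -> l <= 4 * (t * q) -> delta <= m1 * q -> n1 * q <= 2 * K ->
  0 <= D -> D <= 2 * n1 -> S <= theta * l ->
  16 <= M * (delta * eps) -> q <= delta * eps / 4 -> theta * (64 * K) <= eps ->
  theta <= eps / 4 ->
  ((M * l)^-1 * t + 1) / m1 + D * S / t + (M * l)^-1 * S <= eps.
Proof.
move=> t0 l0 q0 M1 th0 de0 K0 m0 tq lt dm nK D0 Dn Sl Mde qde thK the.
have M0 : 0 < M by lra.
have Ml0 : 0 < M * l by rewrite mulr_gt0.
have e1 : ((M * l)^-1 * t + 1) / m1 <= eps / 2.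
  rewrite ler_pdivrMr// -(ler_pM2r q0) mulrDl mul1r.
  have a1 : (M * l)^-1 * t * q <= delta * eps / 4.
    rewrite -mulrA mulrC ler_pdivrMr//.
    have : l * 16 <= l * (M * (delta * eps)) by rewrite ler_pM2l.
    by move: tq; lra.
  have eps0 : 0 < eps by lra.
  have : delta * (eps / 2) <= m1 * q * (eps / 2) by rewrite ler_pM2r// divr_gt0.
  by move: a1 qde; lra.
have e2 : D * S / t <= eps / 4.
  rewrite ler_pdivrMr//.
  have b1 : D * S <= D * (theta * l) by rewrite ler_wpM2l.
  have tl0 : 0 < theta * l by rewrite mulr_gt0.
  have b2 : D * (theta * l) <= 2 * n1 * (theta * l) by rewrite ler_pM2r.
  have n0 : 0 <= n1 by lra.
  have b3 : n1 * theta * l <= n1 * theta * (4 * (t * q)).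
    by rewrite ler_wpM2l// mulr_ge0// ltW.
  have b4 : theta * t * (n1 * q) <= theta * t * (2 * K).
    by rewrite ler_pM2l// mulr_gt0.
  have b5 : t * (theta * (64 * K)) <= t * eps by rewrite ler_pM2l.
  by move: b1 b2 b3 b4 b5; lra.
have e3 : (M * l)^-1 * S <= eps / 4.
  rewrite mulrC ler_pdivrMr//.
  have c1 : theta * l <= eps / 4 * l by rewrite ler_pM2r.
  have c2 : eps / 4 * l * 1 <= eps / 4 * l * M by rewrite ler_wpM2l// mulr_ge0; lra.
  by move: c1 c2 Sl; lra.
lra.
Qed.

Lemma main_bound eps eta : 0 < eps -> 0 < eta -> exists T : R, forall t, T <= t ->
  (P [set w | (eps < `| BTM_prob Q (fun z => sig z w) V t (Gamma P sig t w) - 1 |)%R]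
     <= eta%:E)%E.
Proof.
move=> eps0 eta0.
pose p := tailp P sig.
have p_noninc x y : x <= y -> p y <= p x by exact: tailp_noninc.
have p_gt0 x : 0 < p x by exact: tailp_gt0.
have p_le1 x : p x <= 1 by exact: tailp_le1.
have p_slow : forall M e : R, 0 < M -> 0 < e ->
    exists2 X : R, 0 < X & forall u, X <= u -> p u <= (1 + e) * p (u * M).
  by move=> M e; exact: tailp_slow.
(* With [n * q >= K], a stretch of [n] sites has no deep site with probability at most
   [1 / K <= eta / 8]. *)
pose K : R := 8 / eta + 1.
have K1 : 1 <= K by rewrite lerDr divr_ge0// ltW.
have K0 : 0 < K by lra.
(* The window will satisfy [size win * q <= 7 * K], so a bad event of probability at most [e2 * q]
   per site costs at most [eta / 4] in all. *)
pose e2 : R := eta / (28 * K).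
have e20 : 0 < e2 by rewrite divr_gt0// mulr_gt0.
have Ke2 : 28 * K * e2 = eta.
  by rewrite /e2 mulrC divfK// gt_eqF// mulr_gt0.
(* Close pairs of deep sites cost at most [delta * q] per site. The bound by 1, with [q <= 1 <= K],
   is what keeps [size win * q] below [7 * K]. *)
pose delta : R := Num.min 1 e2.
have delta0 : 0 < delta by rewrite lt_min ltr01.
have delta1 : delta <= 1 by rewrite ge_min lexx.
have deltae2 : delta <= e2 by rewrite ge_min lexx orbT.
pose M : R := 16 / (delta * eps) + 1.
have de0 : 0 < delta * eps by rewrite mulr_gt0.
have M1 : 1 <= M by rewrite lerDr divr_ge0// ltW.
have Mde : 16 <= M * (delta * eps).
  by rewrite /M mulrDl divfK ?gt_eqF// lerDl mul1r ltW.
pose theta : R := Num.min (eps / (64 * K)) (eps / 4).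
have K64 : 0 < 64 * K by rewrite mulr_gt0.
have theta0 : 0 < theta by rewrite lt_min !divr_gt0.
have thK : theta * (64 * K) <= eps by rewrite -ler_pdivlMr// ge_min lexx.
have th4 : theta <= eps / 4 by rewrite ge_min lexx orbT.
have M0 : 0 < M by lra.
have [X1 X10 hX1] := p_slow M e2 M0 e20.
(* Markov's inequality at level [theta * l] divides the truncated mean by [theta * l], leaving
   [e2 * q] per site. *)
have the0 : 0 < theta * e2 by rewrite mulr_gt0.
have [X2 X20 hX2] := karamata p_noninc p_gt0 p_slow
  (trunc_mean_le P msig sig_gt0) (trunc_mean_half (P := P) msig idd sig_gt0) the0.
have de40 : 0 < delta * eps / 4 by rewrite divr_gt0.
have [X3 hX3] := tailp_small P msig de40.
pose X := Num.max X1 (Num.max X2 X3).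
have X0 : 0 <= X by rewrite le_max ltW.
have [T1 hT1] := ell_large p_noninc p_gt0 p_le1 X0.
have [T2 hT2] := ell_balance p_noninc p_gt0 p_le1 p_slow.
exists (Num.max 1 (Num.max T1 T2)) => t.
rewrite !ge_max => /andP[t1 /andP[/hT1 + /hT2]].
rewrite -[inf _]/(ell P sig t); set l := ell P sig t.
rewrite /X !ge_max => /andP[/[dup] lX1 /hX1 slow /andP[lX2 lX3]] [tq lt].
have l0 : 0 < l by exact: lt_le_trans lX1.
set q := p l in tq lt slow.
have q0 : 0 < q by exact: p_gt0.
have q1 : q <= 1 by exact: p_le1.
have qde : q <= delta * eps / 4 by exact: hX3.
have pMq : p (l * M) <= q by apply: p_noninc; rewrite ler_peMr// ltW.
have Kq0 : 0 <= K / q by rewrite divr_ge0// ltW.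
have dq0 : 0 <= delta / q by rewrite divr_ge0// ltW.
(* [n] is rounded up so that deep sites are found. [m] is rounded down: [m * q <= delta] limits the
   close pairs, while [m.+1 * q >= delta] serves the exit bound. *)
pose n := (Num.truncn (K / q)).+1; pose m := Num.truncn (delta / q).
have /andP[n_le n_gt] := truncn_itv Kq0; have /andP[m_le m_gt] := truncn_itv dq0.
have nq1 : K <= n%:R * q by rewrite -ler_pdivrMr// ltW.
have nq2 : n%:R * q <= 2 * K.
  by move: n_le; rewrite ler_pdivlMr// /n -natr1; lra.
have mq1 : m%:R * q <= delta by rewrite -ler_pdivlMr.
have mq2 : delta <= m.+1%:R * q by rewrite -ler_pdivrMr// ltW.
pose win := window (n + m).
have sz : (size win)%:R * q <= 7 * K.
  rewrite size_map size_iota natrD natrM natrD.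
  by move: nq2 mq1; move: (n%:R) (m%:R) => x y; lra.
(* The bad events [A1] to [A5] negate, in order, the five hypotheses of [first_sites] that follow
   positivity. *)
pose A1 := \bigcap_(z in [set z | z \in [seq i.+1%:Z | i <- iota 0 n]])
  sig z @^-1` `]-oo, l]%classic.
pose A2 := \bigcap_(z in [set z | z \in [seq - i%:Z | i <- iota 0 n]])
  sig z @^-1` `]-oo, l]%classic.
pose A3 := \big[setU/set0]_(y <- win) [set w | l < sig y w <= l * M].
pose A4 := \big[setU/set0]_(y <- win) \big[setU/set0]_(i <- iota 0 m)
  ([set w | l < sig y w] `&` [set w | l < sig (y + i.+1%:Z) w]).
pose A5 := [set w | theta * l < \sum_(y <- win) sig y w * (sig y w <= l)%R%:R].
have mray z : measurable (sig z @^-1` `]-oo, l]%classic).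
  by apply: measurable_preimageT => //; exact: measurable_itv.
have mA1 : measurable A1.
  by rewrite /A1 bigcap_seq; apply: bigsetI_measurable => z _; exact: mray.
have mA2 : measurable A2.
  by rewrite /A2 bigcap_seq; apply: bigsetI_measurable => z _; exact: mray.
have mband y : measurable [set w | l < sig y w <= l * M] by exact: measurable_band.
have mA3 : measurable A3 by apply: bigsetU_measurable.
have mpair y (i : nat) : measurable ([set w | l < sig y w] `&`
    [set w | l < sig (y + i.+1%:Z) w]).
  by apply: measurableI; exact: measurable_deep.
have mA4 : measurable A4.
  by apply: bigsetU_measurable => y _; apply: bigsetU_measurable => i _; exact: mpair.
have mtr y : measurable_fun setT (fun w => sig y w * (sig y w <= l)%R%:R).
  apply: measurable_funM => //.
  rewrite (_ : (fun _ => _) = \1_[set w | sig y w <= l]).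
    by apply: measurable_indic; exact: measurable_set_le.
  apply/funext => w; rewrite indicE; congr (nat_of_bool _)%:R.
  by apply/idP/idP; rewrite inE.
have mA5 : measurable A5.
  by apply: measurable_set_lt => //; apply: measurable_sum.
have K8 : K^-1 <= eta / 8.
  rewrite -[leLHS]mul1r ler_pdivrMr// /K mulrDr mulrA divfK ?gt_eqF// mulr1.
  by rewrite divff ?gt_eqF// lerDl divr_ge0// ltW.
have nq0 : 0 < n%:R * q := lt_le_trans K0 nq1.
have nqK : (n%:R * q)^-1 <= eta / 8 by apply: le_trans K8; rewrite lef_pV2.
have P1 : (P A1 <= (eta / 8)%:E)%E.
  have inj1 : injective (fun i : nat => i.+1%:Z) by move=> i j [].
  have := no_deep_le msig ind idd sv n l inj1; rewrite -lee_pdivlMr// mul1e.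
  by move=> /le_trans; apply; rewrite lee_fin.
have P2 : (P A2 <= (eta / 8)%:E)%E.
  have inj2 : injective (fun i : nat => - i%:Z) by move=> i j /oppr_inj [].
  have := no_deep_le msig ind idd sv n l inj2; rewrite -lee_pdivlMr// mul1e.
  by move=> /le_trans; apply; rewrite lee_fin.
have sum_cst (I : Type) (r : seq I) (c : R) :
    (\sum_(y <- r) c%:E = ((size r)%:R * c)%:E)%E.
  elim: r => [|y r IH]; first by rewrite big_nil mul0r.
  by rewrite big_cons IH -EFinD /= -nat1r mulrDl mul1r.
have P3 : (P A3 <= (eta / 4)%:E)%E.
  apply: le_trans (measure_bigsetU_seq_le _ _ mband) _.
  rewrite (eq_bigr (fun=> (q - p (l * M))%:E)) => [|y _]; last first.
    by apply: bandE => //; rewrite ler_peMr// ltW.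
  rewrite sum_cst lee_fin.
  have h : q - p (l * M) <= e2 * q.
    have : e2 * p (l * M) <= e2 * q by rewrite ler_pM2l.
    by move: slow; lra.
  apply: (@le_trans _ _ ((size win)%:R * (e2 * q))); first by rewrite ler_wpM2l.
  have : (size win)%:R * q * e2 <= 7 * K * e2 by rewrite ler_pM2r.
  by move: Ke2; lra.
have P4 : (P A4 <= (eta / 4)%:E)%E.
  apply: le_trans (measure_bigsetU_seq_le _ _ _) _.
    by move=> y; apply: bigsetU_measurable => i _; exact: mpair.
  apply: (@le_trans _ _ (\sum_(y <- win) (m%:R * q ^+ 2)%:E)%E).
    apply: lee_sum => y _.
    apply: le_trans (measure_bigsetU_seq_le _ _ (mpair y)) _.
    rewrite (eq_bigr (fun=> (q ^+ 2)%:E)) => [|i _]; last first.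
      by apply: pair_le => //; rewrite -subr_eq0 opprD addrA subrr sub0r oppr_eq0.
    by rewrite sum_cst size_iota.
  rewrite sum_cst lee_fin expr2.
  have h1 : (size win)%:R * q * (m%:R * q) <= (size win)%:R * q * delta.
    by rewrite ler_wpM2l// mulr_ge0// ltW.
  have h2 : (size win)%:R * q * delta <= 7 * K * delta by rewrite ler_pM2r.
  have h3 : K * delta <= K * e2 by rewrite ler_pM2l.
  by move: h1 h2 h3 Ke2; lra.
have P5 : (P A5 <= (eta / 4)%:E)%E.
  have thl0 : 0 < theta * l by rewrite mulr_gt0.
  have := mass_le (P := P) msig sig_gt0 win thl0 (ltW l0) (fun y => hX2 y l lX2).
  rewrite -lee_pdivlMl// => /le_trans; apply.
  rewrite -EFinM lee_fin mulrC ler_pdivrMr//.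
  have : theta * l * e2 * ((size win)%:R * q) <= theta * l * e2 * (7 * K).
    by rewrite ler_pM2l// mulr_gt0.
  have : theta * l * (28 * K * e2) = theta * l * eta by rewrite Ke2.
  by rewrite -/p -/q; lra.
have mA45 := measurableU _ _ mA4 mA5.
have mA345 := measurableU _ _ mA3 mA45.
have mA2345 := measurableU _ _ mA2 mA345.
have mA := measurableU _ _ mA1 mA2345.
apply: (@le_trans _ _ (P (A1 `|` (A2 `|` (A3 `|` (A4 `|` A5)))))); last first.
  apply: (@le_trans _ _ ((eta / 8)%:E + ((eta / 8)%:E + ((eta / 4)%:E +
      ((eta / 4)%:E + (eta / 4)%:E))))%E); last by rewrite -!EFinD lee_fin; lra.
  apply: le_trans (measureU2 _ mA1 mA2345) _; apply: leeD => //.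
  apply: le_trans (measureU2 _ mA2 mA345) _; apply: leeD => //.
  apply: le_trans (measureU2 _ mA3 mA45) _; apply: leeD => //.
  by apply: le_trans (measureU2 _ mA4 mA5) _; apply: leeD.
apply: le_measure; rewrite ?inE//; first exact: measurable_target.
move=> w target; apply: contrapT => good.
have ray (f : nat -> int) :
    ~ (\bigcap_(z in [set z | z \in [seq f i | i <- iota 0 n]])
      sig z @^-1` `]-oo, l]%classic) w -> exists2 i, (i < n)%N & l < sig (f i) w.
  move=> h; apply: contrapT => h2; apply: h => z /mapP[i]; rewrite mem_iota => /andP[_ iN] ->.
  rewrite /= in_itv/= leNgt; apply/negP => ly; apply: h2; by exists i.
have g1 := ray _ (fun h : A1 w => good (or_introl h)).
have g2 := ray _ (fun h : A2 w => good (or_intror (or_introl h))).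
have g3 y : y \in win -> ~ (l < sig y w <= M * l).
  move=> yw h; apply: good; right; right; left.
  by rewrite /A3 -bigcup_seq; exists y; rewrite //= [l * M]mulrC.
have g4 y : y \in win -> forall i, (i < m)%N ->
    ~ (l < sig y w /\ l < sig (y + i.+1%:Z) w).
  move=> yw i im h; apply: good; do 3 right; left.
  rewrite /A4 -bigcup_seq; exists y => //; rewrite -bigcup_seq; exists i => //.
  by rewrite /= mem_iota.
have g5 : \sum_(y <- win) sig y w * (sig y w <= l)%R%:R <= theta * l.
  by rewrite leNgt; apply/negP => h; apply: good; do 4 right.
have [z1 [z2 [U [[z10 z20 zn] [lz1 Mz1 b1] [lz2 Mz2 b2] [JU GU] mass]]]] :=
  first_sites (fun z => sig_gt0 z w) g1 g2 g3 g4 g5.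
have Ml0 : 0 < M * l by rewrite mulr_gt0.
have t0 : 0 < t := lt_le_trans ltr01 t1.
have C0 : 0 <= (M * l)^-1 by rewrite invr_ge0 ltW.
have CM x : M * l < x -> 1 <= (M * l)^-1 * x.
  by move=> h; rewrite mulrC ler_pdivlMr// mul1r ltW.
have G1 : Gamma P sig t w z1 by left; split => //; split.
have G2 : Gamma P sig t w z2 by right; split => //; split.
have := BTM_localization QV (fun z => sig_gt0 z w) z10 z20 t0 C0 (CM _ Mz1) (CM _ Mz2)
  JU GU G1 G2.
move: target => /= /lt_le_trans /[apply].
apply/negP; rewrite -leNgt.
apply: (@error_le t l q M theta delta K eps _ n%:R m.+1%:R) => //.
- by rewrite ler0z subr_ge0 (le_trans z20) ?ltW.
- have -> : 2 * n%:R = (2 * n%:Z)%:~R :> R by rewrite intrM.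
  by rewrite ler_int.
Qed.

End main_bound.

Theorem theorem1p1 (R : realType)
  (d : measure_display) (Omega : measurableType d) (P : probability Omega R)
  (sig : int -> Omega -> R)
  (dW : measure_display) (W : measurableType dW) (Q : probability W R)
  (V : nat + nat -> W -> R) :
  (forall z, measurable_fun setT (sig z)) ->
  mutually_independent P sig ->
  identically_distributed P sig ->
  (forall z w, 0 < sig z w) ->
  slowly_varying (Ltail P sig) ->
  BTM_randomness Q V ->
  forall eps : R, 0 < eps ->
    (fun t : R => P [set w | eps <
        `| BTM_prob Q (fun z => sig z w) V t (Gamma P sig t w) - 1 |])
      @ +oo --> 0%E.
Proof.
move=> msig ind idd sig_gt0 sv QV eps eps0.
apply/fine_cvgP; split.
  by near=> t; apply: fin_num_measure; exact: measurable_target.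
apply/cvgrPdist_le => eta eta0.
have [T hT] := main_bound msig ind idd sig_gt0 sv QV eps0 eta0.
near=> t; rewrite sub0r normrN ger0_norm ?fine_ge0//=.
rewrite -lee_fin fineK; first by apply: hT; near: t; apply: nbhs_pinfty_ge; exact: num_real.
by apply: fin_num_measure; exact: measurable_target.
Unshelve. all: by end_near.
Qed.
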